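(* Let $G=\mathrm{GL}(2,5)$ be the general linear group of invertible $2\times 2$ matrices over the field with $5$ elements. Then every torsion unit $u$ of the integral group ring $\mathbb{Z}G$ is conjugate to an element of $\pm G$ in the unit group of $\mathbb{Q}G$; i.e., there exist a unit $x$ of $\mathbb{Q}G$ and an element $g\in G$ such that $x^{-1}ux=g$ or $x^{-1}ux=-g$ (where $-g$ denotes the additive inverse of $g$ in the group ring).
   Context: For a finite group $G$, a torsion unit of $\mathbb{Z}G$ is a unit of the ring $\mathbb{Z}G$ of finite multiplicative order, and $\pm G=\{g,-g : g\in G\}\subset\mathbb{Z}G\subset\mathbb{Q}G$, with the minus sign taken in the group ring. *)

(* Defs.v *)
From HB Require Import structures.
From mathcomp Require Import all_boot all_order all_fingroup all_algebra all_field.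

Set Implicit Arguments.
Unset Strict Implicit.
Unset Printing Implicit Defensive.

Import GRing.Theory.

Local Open Scope ring_scope.

(* The group ring R[G] of a finite group: formal sums \sum_g u_g g, encoded by  *)
(* their coefficient functions g |-> u_g. It is a new type rather than an alias *)
(* of {ffun gT -> R}, which already carries the pointwise product.              *)
Record groupRing (R : Type) (gT : finGroupType) :=
  GroupRing { gr_ffun : {ffun gT -> R} }.

Definition gr_coef (R : Type) (gT : finGroupType) (u : groupRing R gT) (g : gT) :=
  gr_ffun u g.
Coercion gr_coef : groupRing >-> Funclass.

HB.instance Definition _ (R : Type) (gT : finGroupType) :=
  [isNew for @gr_ffun R gT].
HB.instance Definition _ (R : eqType) (gT : finGroupType) :=
  [Equality of groupRing R gT by <:].
HB.instance Definition _ (R : choiceType) (gT : finGroupType) :=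
  [Choice of groupRing R gT by <:].

Definition gr_fun (R : Type) (gT : finGroupType) (f : gT -> R) : groupRing R gT :=
  GroupRing (finfun f).

Lemma gr_funE (R : Type) (gT : finGroupType) (f : gT -> R) g : gr_fun f g = f g.
Proof. exact: ffunE. Qed.

Lemma groupRingP (R : Type) (gT : finGroupType) (u v : groupRing R gT) :
  u =1 v -> u = v.
Proof.
by case: u v => [u] [v] euv; congr GroupRing; apply/ffunP => g; apply: euv.
Qed.

Section Zmodule.
Variables (V : zmodType) (gT : finGroupType).
Implicit Types u v w : groupRing V gT.

Definition gr_zero : groupRing V gT := gr_fun (fun=> 0).
Definition gr_opp u : groupRing V gT := gr_fun (fun g => - u g).
Definition gr_add u v : groupRing V gT := gr_fun (fun g => u g + v g).

Fact gr_addA : associative gr_add.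
Proof. by move=> u v w; apply: groupRingP => g; rewrite !gr_funE addrA. Qed.
Fact gr_addC : commutative gr_add.
Proof. by move=> u v; apply: groupRingP => g; rewrite !gr_funE addrC. Qed.
Fact gr_add0 : left_id gr_zero gr_add.
Proof. by move=> u; apply: groupRingP => g; rewrite !gr_funE add0r. Qed.
Fact gr_addN : left_inverse gr_zero gr_opp gr_add.
Proof. by move=> u; apply: groupRingP => g; rewrite !gr_funE addNr. Qed.

HB.instance Definition _ := GRing.isZmodule.Build (groupRing V gT)
  gr_addA gr_addC gr_add0 gr_addN.

Lemma gr0E g : (0 : groupRing V gT) g = 0. Proof. exact: gr_funE. Qed.
Lemma grNE u g : (- u) g = - u g. Proof. exact: gr_funE. Qed.
Lemma grDE u v g : (u + v) g = u g + v g. Proof. exact: gr_funE. Qed.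

Lemma gr_sumE (I : Type) (r : seq I) (P : pred I) (F : I -> groupRing V gT) g :
  (\sum_(i <- r | P i) F i) g = \sum_(i <- r | P i) F i g.
Proof. by elim/big_rec2: _ => [|i _ y _ <-]; rewrite (gr0E, grDE). Qed.
End Zmodule.

(* The image in R[G] of the group element g. *)
Definition gr_of (R : nzRingType) (gT : finGroupType) (g : gT) : groupRing R gT :=
  gr_fun (fun h => (h == g)%:R).

Section Ring.
Variables (R : nzRingType) (gT : finGroupType).
Implicit Types (u v w : groupRing R gT) (g h k : gT).

Definition gr_mul u v : groupRing R gT :=
  gr_fun (fun g => \sum_h u h * v (h^-1 * g)%g).

Lemma gr_ofE g h : gr_of R g h = (h == g)%:R. Proof. exact: gr_funE. Qed.

Fact gr_mulA : associative gr_mul.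
Proof.
move=> u v w; apply: groupRingP => g; rewrite !gr_funE.
under eq_bigr => h _ do rewrite gr_funE mulr_sumr.
under [RHS]eq_bigr => h _ do rewrite gr_funE mulr_suml.
rewrite [RHS]exchange_big; apply: eq_bigr => h _ /=.
rewrite [RHS](reindex_inj (mulgI h)); apply: eq_bigr => k _ /=.
by rewrite mulKg invMg mulgA mulrA.
Qed.

Fact gr_mul1l : left_id (gr_of R 1%g) gr_mul.
Proof.
move=> u; apply: groupRingP => g; rewrite gr_funE (bigD1 1%g) //= gr_ofE eqxx.
rewrite mul1r invg1 mul1g big1 ?addr0 // => h /negPf h1.
by rewrite gr_ofE h1 mul0r.
Qed.

Fact gr_mul1r : right_id (gr_of R 1%g) gr_mul.
Proof.
move=> u; apply: groupRingP => g; rewrite gr_funE (bigD1 g) //= gr_ofE mulVg.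
rewrite eqxx mulr1 big1 ?addr0 // => h hg.
by rewrite gr_ofE -eq_mulVg1 (negPf hg) mulr0.
Qed.

Fact gr_mulDl : left_distributive gr_mul +%R.
Proof.
move=> u v w; apply: groupRingP => g; rewrite grDE !gr_funE -big_split.
by apply: eq_bigr => h _; rewrite grDE mulrDl.
Qed.

Fact gr_mulDr : right_distributive gr_mul +%R.
Proof.
move=> u v w; apply: groupRingP => g; rewrite grDE !gr_funE -big_split.
by apply: eq_bigr => h _; rewrite grDE mulrDr.
Qed.

Fact gr_of1_neq0 : gr_of R (1%g : gT) != 0.
Proof.
apply/eqP => /(congr1 (fun u : groupRing R gT => u 1%g)) /eqP.
by rewrite gr_ofE gr0E eqxx oner_eq0.
Qed.

HB.instance Definition _ := GRing.Zmodule_isNzRing.Build (groupRing R gT)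
  gr_mulA gr_mul1l gr_mul1r gr_mulDl gr_mulDr gr_of1_neq0.

Lemma grME u v g : (u * v) g = \sum_h u h * v (h^-1 * g)%g.
Proof. exact: gr_funE. Qed.

Lemma gr_of1 : gr_of R (1%g : gT) = 1. Proof. by []. Qed.

Lemma gr_ofM g h : gr_of R (g * h)%g = gr_of R g * gr_of R h.
Proof.
apply: groupRingP => k; rewrite grME (bigD1 g) //= !gr_ofE eqxx mul1r.
rewrite big1 ?addr0 => [|l /negPf lg]; last by rewrite gr_ofE lg mul0r.
by rewrite (can2_eq (mulKVg g) (mulKg g)).
Qed.

Lemma gr_of_inj : injective (@gr_of R gT).
Proof.
move=> g h /(congr1 (fun u : groupRing R gT => u g)) /eqP; rewrite !gr_ofE eqxx.
by case: (g =P h) => // _; rewrite oner_eq0.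
Qed.

Definition gr_scale (a : R) u : groupRing R gT := gr_fun (fun g => a * u g).

Fact gr_scaleA a b u : gr_scale a (gr_scale b u) = gr_scale (a * b) u.
Proof. by apply: groupRingP => g; rewrite !gr_funE mulrA. Qed.
Fact gr_scale1 : left_id 1 gr_scale.
Proof. by move=> u; apply: groupRingP => g; rewrite !gr_funE mul1r. Qed.
Fact gr_scaleDr : right_distributive gr_scale +%R.
Proof. by move=> a u v; apply: groupRingP => g; rewrite !gr_funE mulrDr. Qed.
Fact gr_scaleDl u : {morph gr_scale^~ u : a b / a + b}.
Proof. by move=> a b; apply: groupRingP => g; rewrite !gr_funE mulrDl. Qed.

HB.instance Definition _ := GRing.Zmodule_isLmodule.Build R (groupRing R gT)
  gr_scaleA gr_scale1 gr_scaleDr gr_scaleDl.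

Lemma grZE (a : R) u g : (a *: u) g = a * u g. Proof. exact: gr_funE. Qed.

Lemma gr_sum u : u = \sum_g u g *: gr_of R g.
Proof.
apply: groupRingP => h; rewrite gr_sumE (bigD1 h) //= grZE gr_ofE eqxx mulr1.
rewrite big1 ?addr0 // => g gh.
by rewrite grZE gr_ofE eq_sym (negPf gh) mulr0.
Qed.

Fact gr_scaleAl (a : R) u v : a *: (u * v) = (a *: u) * v.
Proof.
apply: groupRingP => g; rewrite grZE !grME mulr_sumr.
by apply: eq_bigr => h _; rewrite grZE mulrA.
Qed.
HB.instance Definition _ := GRing.Lmodule_isLalgebra.Build R (groupRing R gT)
  gr_scaleAl.

Definition gr_row u : 'rV[R]_#|gT| := \row_i u (enum_val i).

Fact gr_vect : Vector.axiom #|gT| (groupRing R gT).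
Proof.
exists gr_row => [a u v|].
  by apply/rowP => i; rewrite !mxE grDE grZE.
exists (fun r : 'rV[R]_#|gT| => gr_fun (fun g => r ord0 (enum_rank g))) => [u|r].
  by apply: groupRingP => g; rewrite gr_funE mxE enum_rankK.
by apply/rowP => i; rewrite mxE gr_funE enum_valK.
Qed.
HB.instance Definition _ := Lmodule_hasFinDim.Build R (groupRing R gT) gr_vect.
End Ring.

Fact gr_scaleAr (R : comNzRingType) (gT : finGroupType) (a : R)
  (u v : groupRing R gT) : a *: (u * v) = u * (a *: v).
Proof.
apply: groupRingP => g; rewrite grZE !grME mulr_sumr.
by apply: eq_bigr => h _; rewrite grZE mulrCA.
Qed.
HB.instance Definition _ (R : comNzRingType) (gT : finGroupType) :=
  GRing.Lalgebra_isAlgebra.Build R (groupRing R gT) (@gr_scaleAr R gT).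

(* Over a field this equips R[G] with GRing.unit and ^-1. *)
HB.instance Definition _ (F : fieldType) (gT : finGroupType) :=
  Algebra_isFalgebra.Build F (groupRing F gT).

(* Coefficientwise extension of f; it is the inclusion ZG -> QG for f = intr. *)
Definition gr_map (R S : Type) (gT : finGroupType) (f : R -> S)
  (u : groupRing R gT) : groupRing S gT := gr_fun (fun g => f (u g)).

Section Map.
Variables (R S : nzRingType) (gT : finGroupType) (f : {rmorphism R -> S}).

Lemma gr_map_of g : gr_map f (gr_of R g) = gr_of S g :> groupRing S gT.
Proof. by apply: groupRingP => h; rewrite !gr_funE rmorph_nat. Qed.

Fact gr_map_is_additive : zmod_morphism (@gr_map R S gT f).
Proof.
move=> u v; apply: groupRingP => g.
by rewrite grDE grNE !gr_funE -rmorphB; congr (f _); rewrite grDE grNE.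
Qed.

Fact gr_map_is_multiplicative : monoid_morphism (@gr_map R S gT f).
Proof.
split=> [|u v]; first exact: gr_map_of.
apply: groupRingP => g; rewrite grME gr_funE grME rmorph_sum.
by apply: eq_bigr => h _; rewrite !gr_funE rmorphM.
Qed.

HB.instance Definition _ :=
  GRing.isZmodMorphism.Build (groupRing R gT) (groupRing S gT) (@gr_map R S gT f)
    gr_map_is_additive.
HB.instance Definition _ :=
  GRing.isMonoidMorphism.Build (groupRing R gT) (groupRing S gT)
    (@gr_map R S gT f) gr_map_is_multiplicative.
End Map.

(* ZG has no unitRingType instance, so invertibility is spelled out here. *)
Definition torsion_unit (A : nzRingType) (u : A) : Prop :=
  (exists v : A, v * u = 1 /\ u * v = 1) /\
  (exists n : nat, (0 < n)%N /\ u ^+ n = 1).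

(* Main.v *)
From HB Require Import structures.
From mathcomp Require Import all_boot all_order all_fingroup all_algebra all_field.
From mathcomp Require Import cyclic center pgroup sylow mxrepresentation classfun character.
From mathcomp Require Import zify ring.
Require Import Defs.
Set Implicit Arguments.
Unset Strict Implicit.
Unset Printing Implicit Defensive.
Import Order.TTheory GRing.Theory Num.Theory.
Local Open Scope ring_scope.

(* By strong induction on the least k such that u ^+ k is a scalar matrix z,  *)
(* every torsion unit u of augmentation 1 has the same partial augmentations  *)
(* (sums of coefficients over conjugacy classes) as some group element; then  *)
(* the same holds for all powers of u, and comparing the characters of the    *)
(* two bimodule structures on QG gives conjugacy. The partial augmentation of *)
(* u vanishes at g unless g ^+ k = z (Berman-Higman for g central, Hertweck   *)
(* in general), modulo a prime p | k the partial augmentations of u determine *)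
(* those of u ^+ p, the determinant maps u to a group element, and a trace    *)
(* bound limits the sum of squares. These constraints leave k prime, k = 4    *)
(* and k = 6; the last two are settled by the traces modulo 5 of the natural  *)
(* representation of GL(2, 5) and of its symmetric square.                    *)

(** * Integer matrices of finite order *)

(** Up to the sign of [u] the augmentation is 1, and the proof has two halves. The first is general:
    the space CG, with powers of [u] acting on the left and G on the right, has as character values
    the partial augmentations of the powers of [u] times centralizer orders. If these agree with
    those of the powers of a group element g, the two modules are isomorphic over C; an isomorphism
    is left multiplication by a unit w with w u = g w, and since this linear system is rational it
    also has a rational invertible solution ([eps_conjugate]). Matching [u] itself suffices once
    every power is known to match some element: the congruence modulo p for p-th powers identifies
    which one ([same_eps_exp]).

    The second half finds g ([torsion_same_eps]). Let k be least with u^k a scalar matrix z. If k >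
    1, [u] vanishes at scalar matrices, and the other classes of GL(2, 5) are given by trace and
    determinant, so the unknowns are 20 integers. Only classes with g^k = z can occur
    ([eps_power_central]): otherwise a power of x -> u x g^-1 is right translation by an element of
    prime order p, the module is free over it modulo p, and the trace vanishes ([free_trace_eq0]).

    The remaining integers have sum 1, sums 0 or 1 over each determinant ([det_sums]), a sum of
    squares at most 40 ([sum_param_eps_sqr]), and for a prime p dividing k with p < k, prescribed
    sums modulo p ([prime_power_sum]). Element orders in PGL(2, 5) are at most 6, whence k <= 6 p
    and a short list of k. For k = 2, 3, 5 a single class is available; 8, 9, 12 and 25 leave no
    class; 10 and 15 contradict the constraints. For k = 4 and k = 6 the image of [u] in the natural
    representation modulo 5, and for k = 6 also in its symmetric square, gives the missing
    congruences ([power4_same_eps], [power6_same_eps]). *)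

Lemma norm_root1 (N : nat) (x : algC) : (0 < N)%N -> x ^+ N = 1 -> `|x| = 1.
Proof.
move=> N_gt0 xN; apply/eqP; rewrite -(@pexpr_eq1 _ _ N) -?lt0n ?normr_ge0 //.
by rewrite -normrX xN normr1.
Qed.

Section FiniteOrderMatrix.
Variables (n N : nat) (A : 'M[algC]_n).
Hypotheses (N_gt0 : (0 < N)%N) (AN1 : A ^+ N = 1).

Lemma finite_order_diag : exists2 P : 'M[algC]_n, P \in unitmx &
  exists2 d : 'rV[algC]_n, P *m A = diag_mx d *m P & forall i, d 0 i ^+ N = 1.
Proof.
case: n A AN1 => [|n'] A' A'N1.
  by exists 1%:M; rewrite ?unitmx1 //; exists 0; [apply/matrixP => -[] | case].
have [z prim_z] := C_prim_root_exists N_gt0.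
have [] := (@mxpoly.diagonalizableP _ _ A').2.
  exists [seq z ^+ val i | i <- index_enum 'I_N].
    rewrite map_inj_uniq ?index_enum_uniq // => i j /eqP.
    by rewrite (eq_prim_root_expr prim_z) !modn_small ?ltn_ord // => /eqP/val_inj ->.
  rewrite big_map -(big_mkord xpredT (fun i => 'X - (z ^+ i)%:P)).
  rewrite (factor_Xn_sub_1 prim_z); apply: mxminpoly_min.
  by rewrite rmorphB rmorphXn rmorph1 /= horner_mx_X A'N1 subrr.
move=> P Pu /mxpoly.diagonalizable_forPex[d /(mxpoly.simmxP Pu) dP]; exists P => //.
exists d => // i; apply/eqP.
have dN k : P *m A' ^+ k = diag_mx (\row_j (d 0 j ^+ k)) *m P.
  elim: k => [|k IHk].
    by rewrite expr0 mulmx1 -[LHS]mul1mx; congr (_ *m _); apply/matrixP=> a b; rewrite !mxE.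
  rewrite exprSr -mulmxE mulmxA IHk -mulmxA dP mulmxA; congr (_ *m _).
  by rewrite mulmx_diag; congr diag_mx; apply/rowP => j; rewrite !mxE exprSr.
have := dN N; rewrite A'N1 mulmx1 -{1}[P]mul1mx => /(can_inj (mulmxK Pu)).
by move/matrixP/(_ i i); rewrite !mxE eqxx => /eqP; rewrite eq_sym.
Qed.

Lemma finite_order_trace_le : `|\tr A| <= n%:R.
Proof.
have [P Pu [d dP dN]] := finite_order_diag.
have ->: A = invmx P *m diag_mx d *m P by rewrite -mulmxA -dP mulKmx.
rewrite mxtrace_mulC mulmxA mulmxV // mul1mx mxtrace_diag.
apply: le_trans (ler_norm_sum _ _ _) _.
rewrite -[n%:R]mulr_natl mulr1 -[n in n%:R]card_ord -sumr_const.
by apply: ler_sum => i _; rewrite (norm_root1 N_gt0 (dN i)).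
Qed.

(** Equality in the triangle inequality makes all eigenvalues equal, and a diagonalizable matrix
    with one eigenvalue is scalar. *)
Lemma finite_order_trace_max : `|\tr A| = n%:R -> exists a : algC, A = a%:M.
Proof.
have [P Pu [d dP dN]] := finite_order_diag.
have DA: A = invmx P *m diag_mx d *m P by rewrite -mulmxA -dP mulKmx.
rewrite {1}DA mxtrace_mulC mulmxA mulmxV // mul1mx mxtrace_diag => tr_max.
have d1 i: `|d 0 i| = 1 by exact: norm_root1 N_gt0 (dN i).
case: (normC_sum_eq1 (F := d 0) (P := xpredT)) => // [|a a1 da].
  by rewrite tr_max -[n in n%:R]card_ord -sumr_const; apply: eq_bigr => i _; rewrite d1.
exists a; rewrite DA (_ : diag_mx d = a%:M).
  by rewrite mul_mx_scalar -scalemxAl mulVmx // scalemx1.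
by apply/matrixP => i j; rewrite !mxE da.
Qed.

Lemma finite_order_trace_inv (B : 'M[algC]_n) : A *m B = 1 -> \tr B = (\tr A)^*.
Proof.
have [P Pu [d dP dN]] := finite_order_diag => AB.
have DA: A = invmx P *m diag_mx d *m P by rewrite -mulmxA -dP mulKmx.
have DB: B = invmx P *m diag_mx (map_mx Num.conj d) *m P.
  have [Au _] := mulmx1_unit AB; apply: (can_inj (mulKmx Au)); rewrite AB DA.
  rewrite -!mulmxA (mulmxA P) mulmxV // mul1mx (mulmxA (diag_mx d)) mulmx_diag.
  rewrite (_ : diag_mx _ = 1%:M) ?mul1mx ?mulVmx //.
  apply/matrixP => i j; by rewrite !mxE -normCK (norm_root1 N_gt0 (dN _)) expr1n.
rewrite DA DB !(mxtrace_mulC _ P) !mulmxA mulmxV // !mul1mx !mxtrace_diag.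
by rewrite rmorph_sum; apply: eq_bigr => i _; rewrite mxE.
Qed.
End FiniteOrderMatrix.

(** * Ranks under reduction modulo a prime *)

Lemma exists_unit_minor (F : fieldType) m n (B : 'M[F]_(m, n)) :
  exists f : 'I_(\rank B) -> 'I_m, exists g : 'I_(\rank B) -> 'I_n,
  mxsub f g B \in unitmx.
Proof.
have fullB: row_full (rowsub (maxrankfun B) B)^T.
  by rewrite /row_full mxrank_tr; have := maxrowsub_free B.
exists (maxrankfun B), (fullrankfun fullB).
rewrite -unitmx_tr; have:= fullrowsub_unit fullB; congr (_ \in unitmx).
by apply/matrixP => i j; rewrite !mxE.
Qed.

Lemma unit_minor_rank (F : fieldType) m n r (B : 'M[F]_(m, n)) f g :
  (mxsub f g B : 'M_r) \in unitmx -> (r <= \rank B)%N.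
Proof.
move=> Bu; rewrite -(mxrank_unit Bu).
have ->: mxsub f g B = rowsub f 1%:M *m B *m colsub g 1%:M.
  by rewrite mul_rowsub_mx mul1mx mulmx_colsub mulmx1; apply/matrixP => i j; rewrite !mxE.
exact: leq_trans (mxrankM_maxl _ _) (mxrankM_maxr _ _).
Qed.

Section RootOfUnityReduction.
Variables (N : nat) (z : algC) (k : fieldType) (w : k).
Hypotheses (prim_z : N.-primitive_root z)
  (root_w : root (map_poly (intr : int -> k) 'Phi_N) w).

(** The minimal polynomial of [z] is the monic integer polynomial ['Phi_N], which also kills [w]; so
    z -> w defines a ring morphism from Z[z] to [k]. *)
Lemma root_reduction (P : {poly int}) :
  root (map_poly (intr : int -> algC) P) z -> root (map_poly (intr : int -> k) P) w.
Proof.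
have monPhi := Cyclotomic_monic N; have := Pdiv.RingMonic.rdivp_eq monPhi P.
set Q := Pdiv.Ring.rdivp _ _; set R := Pdiv.Ring.rmodp _ _ => DP.
have szR: (size R < size 'Phi_N)%N by rewrite Pdiv.Ring.ltn_rmodpN0 ?monic_neq0.
have Phiz: root (map_poly (intr : int -> algC) 'Phi_N) z.
  by rewrite (Cintr_Cyclotomic prim_z) root_cyclotomic.
rewrite DP !rmorphD !rmorphM /= /root !hornerD !hornerM.
rewrite (rootP Phiz) (rootP root_w) !mulr0 !add0r => Rz.
suffices ->: R = 0 by rewrite rmorph0 horner0.
apply: contraTeq szR => nzR; rewrite -leqNgt.
have [p [Dp _] dv_p] := minCpolyP z.
have: root (map_poly ratr (map_poly intr R)) z.
  rewrite -map_poly_comp (eq_map_poly (g := intr)) // => a.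
  by rewrite /= ratr_int.
rewrite dv_p => /dvdp_leq; rewrite map_poly_eq0_id0 ?intr_eq0 ?lead_coef_eq0 //.
move=> /(_ nzR); rewrite [size (map_poly _ R)]size_map_inj_poly //; last exact: intr_inj.
apply: leq_trans; rewrite -(size_map_poly (ratr : rat -> algC)) -Dp.
rewrite (minCpoly_cyclotomic prim_z) -(Cintr_Cyclotomic prim_z).
by rewrite size_map_inj_poly //; exact: intr_inj.
Qed.

(** A minor that is nonzero at [w] is nonzero at [z], so specialization can only lower the rank. *)
Lemma rank_reduction m n (A : 'M[{poly int}]_(m, n)) :
  (\rank (map_mx (fun P => (map_poly (intr : int -> k) P).[w]) A)
     <= \rank (map_mx (fun P => (map_poly (intr : int -> algC) P).[z]) A))%N.
Proof.
set Aw := map_mx _ A; set Az := map_mx _ A.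
have [f [g]] := exists_unit_minor Aw; set r := \rank Aw => Awu.
apply: (@unit_minor_rank _ _ _ _ _ f g); move: Awu; rewrite !unitmxE !unitfE.
have Dw: \det (mxsub f g Aw) = (map_poly intr (\det (mxsub f g A))).[w].
  rewrite -[RHS]/((horner_eval w \o map_poly intr) _) -det_map_mx.
  by congr (\det _); apply/matrixP => i j; rewrite !mxE.
have Dz: \det (mxsub f g Az) = (map_poly intr (\det (mxsub f g A))).[z].
  rewrite -[RHS]/((horner_eval z \o map_poly intr) _) -det_map_mx.
  by congr (\det _); apply/matrixP => i j; rewrite !mxE.
by rewrite Dw Dz; apply: contra => /root_reduction.
Qed.
End RootOfUnityReduction.

(** * Unipotent matrices with Jordan blocks of maximal size *)

Section ConvexSequence.
Variables (m : nat) (g : nat -> nat).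
Hypotheses (g0 : g 0 = 0%N)
  (g_convex : forall t, (t.+2 <= m)%N -> (2 * g t.+1 <= g t + g t.+2)%N).

Lemma convex_ratio_step s : (s < m)%N -> (s.+1 * g s <= s * g s.+1)%N.
Proof.
elim: s => [|s IHs] lt_sm; first by rewrite g0.
have := g_convex lt_sm; have := IHs (ltnW lt_sm); nia.
Qed.

(** A convex sequence vanishing at 0 has nondecreasing ratio g(s) / s; the division is cleared. *)
Lemma convex_ratio s s' : (s <= s' <= m)%N -> (s' * g s <= s * g s')%N.
Proof.
elim: s' => [|s' IHs] /andP[]; first by rewrite leqn0 => /eqP->.
rewrite leq_eqVlt => /predU1P[-> //|]; rewrite ltnS => le_ss' lt_s'm.
have := convex_ratio_step lt_s'm; have := IHs; rewrite le_ss' ltnW // => /(_ isT).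
case: s' {IHs} le_ss' lt_s'm => [|s'] le_ss' _ le1 le2.
  by move: le_ss'; rewrite leqn0 => /eqP->; rewrite g0.
rewrite -(leq_pmul2l (ltn0Sn s')); nia.
Qed.
End ConvexSequence.

(** By Frobenius' rank inequality, t -> rank B^(m - t) is convex. The hypothesis says that rank B^L
    is as large as Jordan blocks of size at most [m] allow; then all blocks have size [m], and there
    are at most n / m of them. *)
Lemma nilpotent_nullity (F : fieldType) n (B : 'M[F]_n) m L :
    (0 < L < m)%N -> B ^+ m = 0 -> (n * (m - L) <= m * \rank (B ^+ L))%N ->
  (m * (n - \rank B) <= n)%N.
Proof.
move=> /andP[L_gt0 lt_Lm] Bm rkBL.
pose g t := \rank (B ^+ (m - t)).
have := @convex_ratio m g _ _ (m - L) m.-1.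
rewrite /g subn0 Bm mxrank0 subKn ?(ltnW lt_Lm) // => /(_ erefl).
have -> : (m - m.-1 = 1)%N by lia.
rewrite expr1 => le_g; suff: (m.-1 * \rank (B ^+ L) <= (m - L) * \rank B)%N.
  by have := rank_leq_row B; nia.
apply: le_g => [t lt_tm|]; last by lia.
have -> : (m - t = (m - t.+2).+2)%N by lia.
have -> : (m - t.+1 = (m - t.+2).+1)%N by lia.
set s := (m - t.+2)%N; have := mxrank_Frobenius B (B ^+ s) B.
have <- : B *m B ^+ s = B ^+ s.+1 by rewrite exprS.
have -> : B ^+ s *m B = B *m B ^+ s by rewrite mulmxE -exprSr exprS.
have <- : B *m B ^+ s *m B = B ^+ s.+2 by rewrite !mulmxE -exprS -exprSr.
lia.
Qed.

Section CyclotomicRootModp.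
Variables (p c K N : nat) (z : algC) (k : fieldType) (w : k).
Hypotheses (pcharkp : p \in [pchar k]) (K_gt0 : (0 < K)%N) (p'K : ~~ (p %| K)%N).
Hypotheses (defN : N = (p ^ c * K)%N) (prim_z : N.-primitive_root z)
  (root_w : root (map_poly (intr : int -> k) 'Phi_N) w).

(** Injectivity of Frobenius gives w^K = 1. If the order of [w] were a proper divisor of [K], some
    prime l dividing [K] would satisfy w^(N/l) = 1; reducing 1 + z^M + ... + z^(M(l-1)) = 0 with M =
    N/l gives l = 0 in [k], so l = p, which does not divide [K]. *)
Lemma Cyclotomic_root_modp_prim : K.-primitive_root w.
Proof.
have p_pr : prime p := pcharf_prime pcharkp.
have wN: w ^+ N = 1.
  have := root_reduction prim_z root_w (P := 'X^N - 1).
  rewrite !rmorphB !rmorphXn !rmorph1 /= !map_polyX /root !hornerE.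
  rewrite (prim_expr_order prim_z) subrr eqxx => /(_ isT).
  by rewrite subr_eq0 => /eqP.
have wK: w ^+ K = 1.
  elim: c N defN wN => [|c' IHc] N' ->; first by rewrite mul1n.
  move=> wN'; apply: (IHc _ erefl); apply/eqP; rewrite -subr_eq0.
  have: (w ^+ (p ^ c' * K) - 1) ^+ p = 0.
    rewrite -(pFrobenius_autE pcharkp) rmorphB rmorph1 /= pFrobenius_autE -exprM.
    by rewrite mulnAC -expnSr wN' subrr.
  by move/eqP; rewrite expf_eq0 => /andP[].
have [m prim_w m_dvd] := prim_order_exists K_gt0 wK.
suffices -> : K = m by [].
apply/eqP; rewrite eqn_dvd m_dvd andbT; apply: contraT => ndvd.
have m_gt0 := prim_order_gt0 prim_w.
have q_gt1: (1 < K %/ m)%N.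
  rewrite ltnNge; apply: contra ndvd => q_le1.
  suff -> : K = m by [].
  have := divnK m_dvd; case: (K %/ m)%N q_le1 => [|[|]] //= _; last by rewrite mul1n.
  by rewrite mul0n => K0; move: K_gt0; rewrite -K0.
set l := pdiv (K %/ m); have l_pr : prime l := pdiv_prime q_gt1.
have l_dvdK: (l %| K)%N by rewrite -(divnK m_dvd) dvdn_mulr // pdiv_dvd.
pose M := (N %/ l)%N; have Ml: (M * l = N)%N.
  by rewrite divnK // defN dvdn_mull.
have wM: w ^+ M = 1.
  apply/eqP; rewrite -(prim_order_dvd prim_w).
  have /dvdnP[q Dq] := pdiv_dvd (K %/ m); rewrite -/l in Dq.
  rewrite -(dvdn_pmul2r (prime_gt0 l_pr)) Ml defN -(divnK m_dvd) Dq.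
  by apply/dvdn_mull/dvdnP; exists q; rewrite -mulnA (mulnC l).
have := root_reduction prim_z root_w (P := \sum_(i < l) 'X^(M * i)).
have -> : root (map_poly (intr : int -> algC) (\sum_(i < l) 'X^(M * i))) z.
  rewrite rmorph_sum /root horner_sum; under eq_bigr do rewrite /= map_polyXn hornerXn exprM.
  have zM1 : z ^+ M - 1 != 0.
    rewrite subr_eq0 -(prim_order_dvd prim_z) gtnNdvd //.
      by move: (prim_order_gt0 prim_z); rewrite -Ml muln_gt0 => /andP[].
    rewrite -Ml -[ltnLHS]muln1 ltn_pmul2l ?prime_gt1 //.
    by move: (prim_order_gt0 prim_z); rewrite -Ml muln_gt0 => /andP[].
  by rewrite -(mulrI_eq0 _ (mulfI zM1)) -subrX1 -exprM Ml (prim_expr_order prim_z) subrr.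
move=> /(_ isT); rewrite rmorph_sum /root horner_sum.
under eq_bigr do rewrite /= map_polyXn hornerXn exprM wM expr1n.
rewrite sumr_const card_ord -(dvdn_pcharf pcharkp) dvdn_prime2 // => /eqP Dp.
by move: p'K; rewrite Dp l_dvdK.
Qed.
End CyclotomicRootModp.

Lemma expr_sub1_pchar (F : fieldType) p c K n (B : 'M[F]_n) :
  p \in [pchar F] -> (B ^+ K - 1) ^+ (p ^ c) = B ^+ (p ^ c * K) - 1.
Proof.
move=> pcharp; case: n B => [|n] B; first by apply/matrixP => -[].
have pcharX : p \in [pchar {poly F}] by rewrite (rmorph_pchar polyC).
have : ('X^K - 1 : {poly F}) ^+ (p ^ c) = 'X^(p ^ c * K) - 1.
  elim: c => [|c' IHc]; first by rewrite expn0 mul1n expr1.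
  rewrite expnSr exprM IHc -(pFrobenius_autE pcharX) rmorphB rmorph1 /=.
  by rewrite pFrobenius_autE -exprM mulnAC.
move=> /(congr1 (horner_mx B)).
by rewrite rmorphXn !rmorphB !rmorphXn !rmorph1 /= horner_mx_X.
Qed.

Lemma sum_eigen_nullity (F : fieldType) n K (B : 'M[F]_n) (w : F) :
  K.-primitive_root w ->
  (\sum_(i < K) (n - \rank (B - (w ^+ i)%:M)%R) <= n - \rank (B ^+ K - 1)%R)%N.
Proof.
move=> prim_w.
have inj_w : {in xpredT &, injective (fun i : 'I_K => w ^+ i)}.
  move=> i j _ _ /eqP; rewrite (eq_prim_root_expr prim_w) !modn_small //.
  by move/eqP/val_inj.
have := mxdirectP (mxdirect_sum_eigenspace B inj_w) => /= dir.
under eq_bigr => i _ do rewrite -mxrank_ker -[kermx _]/(eigenspace B (w ^+ i)).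
rewrite -dir -mxrank_ker; apply/mxrankS/sumsmx_subP => i _.
apply/sub_kermxP; set V := eigenspace _ _.
have VB : V *m B = w ^+ i *: V by apply/eigenspaceP.
have VBj j : V *m B ^+ j = w ^+ i ^+ j *: V.
  elim: j => [|j IHj]; first by rewrite !expr0 mulmx1 scale1r.
  by rewrite exprSr -mulmxE mulmxA IHj -scalemxAl VB scalerA -exprSr.
rewrite mulmxBr VBj mulmx1 exprAC (prim_expr_order prim_w) expr1n scale1r.
exact: subrr.
Qed.

Lemma sum_ord_periodic c K (f : nat -> nat) :
  (\sum_(a < c * K) f (a %% K) = c * \sum_(i < K) f i)%N.
Proof.
elim: c => [|c IHc]; first by rewrite mul0n big_ord0.
rewrite mulSn big_split_ord mulSn /=; congr addn.
  by apply: eq_bigr => i _; rewrite modn_small.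
by rewrite -IHc; apply: eq_bigr => i _; rewrite modnDl.
Qed.

(* With F = 'F_p, the rank hypothesis says that 'F_p^n is free over the       *)
(* subgroup of order p of the cyclic group generated by A. It forces all      *)
(* Jordan blocks of A modulo p to have the maximal size p^c, which bounds the *)
(* multiplicities of the complex eigenvalues of A by numbers that only depend *)
(* on their p'-parts; counting dimensions, these bounds are attained.         *)
Lemma free_trace_eq0 p c K n (A : 'M[int]_n) :
    prime p -> (0 < K)%N -> ~~ (p %| K)%N -> A ^+ (p ^ c.+1 * K) = 1 ->
    (n <= p * \rank (map_mx (intr : int -> 'F_p) (A ^+ (p ^ c * K) - 1) ^+ p.-1)%R)%N ->
  \tr A = 0.
Proof.
move=> p_pr K_gt0 p'K AN rkA; set N := (p ^ c.+1 * K)%N in AN.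
have p_gt0 := prime_gt0 p_pr.
have N_gt0 : (0 < N)%N by rewrite muln_gt0 expn_gt0 p_gt0.
have [z prim_z] := C_prim_root_exists N_gt0.
have [k [FtoK _]] := countable_algebraic_closure 'F_p.
have pcharFp := pchar_Fp p_pr.
have pchark : p \in [pchar k] by rewrite (rmorph_pchar FtoK).
have [w root_w] : exists w, root (map_poly (intr : int -> k) 'Phi_N) w.
  apply: closed_rootP; rewrite size_map_poly_id0.
    by rewrite size_Cyclotomic eqSS -lt0n totient_gt0.
  by rewrite (monicP (Cyclotomic_monic N)) rmorph1 oner_neq0.
have prim_w := Cyclotomic_root_modp_prim pchark K_gt0 p'K erefl prim_z root_w.
pose Ak := map_mx (intr : int -> k) A; pose AC := map_mx (intr : int -> algC) A.
have ACN : AC ^+ N = 1 by rewrite /AC -rmorphXn AN rmorph1.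
have AkN : Ak ^+ N = 1 by rewrite /Ak -rmorphXn AN rmorph1.
pose nu a := (n - \rank (Ak - (w ^+ a)%:M)%R)%N.
have nu_mod a : nu a = nu (a %% K)%N by rewrite /nu (prim_expr_mod prim_w).
have le_nu : (\sum_(a < N) nu a <= n)%N.
  rewrite (eq_bigr (fun a : 'I_N => nu (a %% K)%N)) => [|a _]; last exact: nu_mod.
  rewrite sum_ord_periodic.
  apply: leq_trans (leq_mul (leqnn _) (sum_eigen_nullity Ak prim_w)) _.
  (* Applied to A^K - 1, whose p^(c+1)-th power is 0 modulo p. The exponent [L] is p^c (p - 1)
     because (A^K - 1)^(p^c) = A^(p^c K) - 1, so that the rank hypothesis is about its L-th
     power. *)
  apply: (@nilpotent_nullity _ _ _ _ (p ^ c * p.-1)%N).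
  - rewrite muln_gt0 expn_gt0 p_gt0 expnS mulnC ltn_pmul2r ?expn_gt0 ?p_gt0 //.
    by have := prime_gt1 p_pr; rewrite /N; lia.
  - by rewrite expr_sub1_pchar // -/N AkN subrr.
  have -> : (p ^ c.+1 - p ^ c * p.-1 = p ^ c)%N.
    by rewrite expnS -[in X in (X * _)%N](prednK p_gt0) mulSn (mulnC p.-1) addnK.
  rewrite expnS mulnC (mulnC p) -mulnA leq_pmul2l ?expn_gt0 ?p_gt0 //.
  rewrite exprM expr_sub1_pchar // /Ak.
  suff <- : map_mx FtoK (map_mx (intr : int -> 'F_p) (A ^+ (p ^ c * K) - 1) ^+ p.-1)
          = (map_mx intr A ^+ (p ^ c * K) - 1) ^+ p.-1 by rewrite mxrank_map.
  rewrite rmorphXn /=; congr (_ ^+ _); rewrite -map_mx_comp.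
  rewrite (@eq_map_mx _ _ _ _ intr) => [|a]; last by rewrite /= rmorph_int.
  by rewrite rmorphB rmorphXn rmorph1.
have [P Pu [d dP dN]] := finite_order_diag N_gt0 ACN.
have DAC : AC = invmx P *m diag_mx d *m P by rewrite -mulmxA -dP mulKmx.
pose mu (a : 'I_N) := #|[set i | d 0 i == z ^+ a]|.
(* Each complex multiplicity is at most the nullity modulo p, since ranks drop under reduction. As
   the multiplicities add up to [n] and the nullities to at most [n], they are equal. *)
have le_mu_nu a : (mu a <= nu a)%N.
  have := rank_reduction prim_z root_w (map_mx polyC A - ('X^a)%:M).
  rewrite (_ : map_mx _ _ = Ak - (w ^+ a)%:M); last first.
    apply/matrixP => i j; rewrite !mxE !rmorphB /= map_polyC rmorphMn /= map_polyXn.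
    by rewrite !hornerE hornerMn hornerXn.
  rewrite (_ : map_mx _ _ = AC - (z ^+ a)%:M); last first.
    apply/matrixP => i j; rewrite !mxE !rmorphB /= map_polyC rmorphMn /= map_polyXn.
    by rewrite !hornerE hornerMn hornerXn.
  move=> le_rk; apply: leq_trans (leq_sub2l n le_rk).
  rewrite -mxrank_ker -[kermx _]/(eigenspace AC (z ^+ a)).
  pose E := rowsub (enum_val (A := mem [set i | d 0 i == z ^+ a])) P.
  have <- : \rank E = mu a.
    apply/eqP/row_freeP; exists (colsub enum_val (invmx P)).
    rewrite /E mulmx_colsub mul_rowsub_mx mulmxV //.
    by apply/matrixP => i j; rewrite !mxE (inj_eq enum_val_inj).
  apply/mxrankS/eigenspaceP; rewrite /E mul_rowsub_mx dP.
  apply/row_matrixP => i; rewrite row_rowsub linearZ /= row_rowsub row_mul row_diag_mx.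
  rewrite -scalemxAl -rowE; congr (_ *: _).
  by have := enum_valP i; rewrite inE => /eqP.
have Dd i : exists a : 'I_N, d 0 i = z ^+ a.
  by have [a ->] := prim_rootP prim_z (dN i); exists a.
have sum_mu (f : 'I_N -> algC) :
    \sum_(a < N) (mu a)%:R * f a = \sum_i \sum_(a < N | d 0 i == z ^+ a) f a.
  under eq_bigr => a _ do rewrite /mu -sum1dep_card natr_sum mulr_suml.
  under eq_bigr => a _ do under eq_bigr => i _ do rewrite mul1r.
  by rewrite (exchange_big_dep xpredT).
have z_inj (a b : 'I_N) : (z ^+ a == z ^+ b) = (a == b).
  by rewrite (eq_prim_root_expr prim_z) !modn_small.
have sum_mu1 : (\sum_(a < N) mu a)%N = n.
  apply/eqP; rewrite -(eqr_nat algC) natr_sum.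
  rewrite -(eq_bigr _ (fun a _ => mulr1 (mu a)%:R)) sum_mu.
  rewrite (eq_bigr (fun=> 1)) ?sumr_const ?card_ord // => i _.
  have [b ->] := Dd i; rewrite (big_pred1 b) // => a.
  by rewrite z_inj eq_sym.
have mu_nu a : mu a = nu a.
  have := leqif_sum (fun a (_ : xpredT a) => leqif_eq (le_mu_nu a)).
  rewrite sum_mu1 => -[le_n eq_n]; have: (n == \sum_(a < N) nu a)%N by rewrite eqn_leq le_n.
  by rewrite eq_n => /forallP/(_ a)/eqP.
have trAC : \tr AC = \sum_(a < N) (nu a)%:R * z ^+ a.
  under eq_bigr => a _ do rewrite -mu_nu.
  rewrite sum_mu DAC mxtrace_mulC mulmxA mulmxV // mul1mx mxtrace_diag.
  apply: eq_bigr => i _; have [b ->] := Dd i; rewrite (big_pred1 b) // => a.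
  by rewrite z_inj eq_sym.
have N'_gt0 : N = N.-1.+1 by rewrite prednK.
pose s (a : 'I_N) : 'I_N := Ordinal (ltn_pmod (a + K) N_gt0).
have s_inj : injective s.
  move=> a b /(congr1 val)/= /eqP; rewrite eqn_modDr !modn_small //.
  by move/eqP/val_inj.
have zK : z ^+ K != 1.
  rewrite -(prim_order_dvd prim_z) gtnNdvd // -[ltnLHS]mul1n ltn_pmul2r //.
  by rewrite -(exp1n c.+1) ltn_exp2r // prime_gt1.
(* The multiplicity of z^a depends only on a modulo [K], so the spectrum is stable under
   multiplication by z^K, which differs from 1. *)
have trAC0 : \tr AC = 0.
  apply/eqP; rewrite -(mulrI_eq0 _ (mulfI (_ : z ^+ K - 1 != 0))) ?subr_eq0 //.
  rewrite mulrBl mul1r subr_eq0 {2}trAC (reindex_inj s_inj) /= trAC mulr_sumr.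
  apply/eqP/eq_bigr => a _; rewrite /=.
  rewrite (nu_mod ((a + K) %% N)%N) modn_dvdm ?dvdn_mull // modnDr -nu_mod.
  by rewrite (prim_expr_mod prim_z) exprD mulrCA (mulrC (z ^+ K)).
apply/eqP; rewrite -(intr_eq0 algC) -[_%:~R]trace_map_mx -/AC trAC0 //.
Qed.

Lemma expr_sub1_pred_pchar (F : fieldType) p n (B : 'M[F]_n) :
  p \in [pchar F] -> (B - 1) ^+ p.-1 = \sum_(i < p) B ^+ i.
Proof.
move=> pcharp; case: n B => [|n] B; first by apply/matrixP => -[].
have p_gt0 := prime_gt0 (pcharf_prime pcharp).
have pcharX : p \in [pchar {poly F}] by rewrite (rmorph_pchar polyC).
have : ('X - 1 : {poly F}) ^+ p.-1 = \sum_(i < p) 'X^i.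
  have nzX1 : 'X - 1 != 0 :> {poly F} by rewrite -[1]/(1%:P) polyXsubC_eq0.
  apply: (mulfI nzX1); rewrite -exprS prednK // -subrX1.
  by rewrite -(pFrobenius_autE pcharX) rmorphB rmorph1 /= pFrobenius_autE.
move=> /(congr1 (horner_mx B)).
rewrite rmorphXn rmorphB rmorph1 rmorph_sum /= horner_mx_X => ->.
by apply: eq_bigr => i _; rewrite rmorphXn /= horner_mx_X.
Qed.

(** * The group ring as a bimodule *)

Section GroupRingMatrix.
Variables (R : comNzRingType) (gT : finGroupType).
Implicit Types (u v w : groupRing R gT) (g h x : gT).

Lemma gr_ofMl x w h : (gr_of R x * w) h = w (x^-1 * h)%g.
Proof.
rewrite grME (bigD1 x) //= gr_ofE eqxx mul1r big1 ?addr0 // => y /negPf xy.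
by rewrite gr_ofE xy mul0r.
Qed.

Lemma gr_ofMr x w h : (w * gr_of R x) h = w (h * x^-1)%g.
Proof.
rewrite grME (bigD1 (h * x^-1)%g) //= gr_ofE invMg invgK mulgKV eqxx mulr1.
rewrite big1 ?addr0 // => y yhx; rewrite gr_ofE; case: eqP; rewrite ?mulr0 // => def_x.
by case/eqP: yhx; rewrite -def_x invMg invgK mulgA mulgV mul1g.
Qed.

Lemma gr_ofX x k : gr_of R (x ^+ k)%g = gr_of R x ^+ k.
Proof. by elim: k => [|k IHk]; rewrite ?gr_of1 // expgS gr_ofM IHk exprS. Qed.

Lemma gr_of_central z w : z \in 'Z([set: gT])%g -> gr_of R z * w = w * gr_of R z.
Proof.
move=> /centerP[_ cz]; apply: groupRingP => h; rewrite gr_ofMl gr_ofMr.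
by congr (w _); apply: (mulgI z); rewrite mulKVg cz ?inE // mulgKV.
Qed.

(** The matrix of x -> v x w in the basis of group elements, acting on row vectors; hence the
    reversed left factors in [gr_mxM]. *)
Definition gr_mx v w : 'M[R]_#|gT| :=
  \matrix_(i, j) (v * gr_of R (enum_val i) * w) (enum_val j).

Lemma gr_mxM v w v' w' : gr_mx v w *m gr_mx v' w' = gr_mx (v' * v) (w * w').
Proof.
apply/matrixP => i j; rewrite !mxE; pose a := v * gr_of R (enum_val i) * w.
under eq_bigr do rewrite !mxE -/a.
rewrite -(reindex (@enum_val gT gT) (P := xpredT)
  (F := fun x => a x * (v' * gr_of R x * w') (enum_val j))) /=; last first.
  by apply: onW_bij; exact: enum_val_bij.
have -> : v' * v * gr_of R (enum_val i) * (w * w') = v' * a * w'.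
  by rewrite /a !mulrA.
rewrite {2}[a]gr_sum mulr_sumr mulr_suml gr_sumE; apply: eq_bigr => x _.
by rewrite -scalerAr -scalerAl grZE.
Qed.

Lemma gr_mx1 : gr_mx 1 1 = 1.
Proof.
by apply/matrixP => i j; rewrite !mxE mul1r mulr1 gr_ofE (inj_eq enum_val_inj) eq_sym.
Qed.

Lemma gr_mxX v w k : gr_mx v w ^+ k = gr_mx (v ^+ k) (w ^+ k).
Proof.
elim: k => [|k IHk]; first by rewrite gr_mx1.
by rewrite exprSr IHk -mulmxE gr_mxM -exprS -exprSr.
Qed.

Lemma gr_mx_central z w : z \in 'Z([set: gT])%g ->
  gr_mx (gr_of R z) w = gr_mx 1 (gr_of R z * w).
Proof.
by move=> cz; apply/matrixP=> i j; rewrite !mxE gr_of_central // mul1r mulrA.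
Qed.

Lemma gr_mx1_of h : gr_mx 1 (gr_of R h) =
  \matrix_(i, j) (enum_val j == enum_val i * h)%g%:R.
Proof. by apply/matrixP => i j; rewrite !mxE mul1r -gr_ofM gr_ofE. Qed.

Lemma trace_gr_mx v w : \tr (gr_mx v w) = \sum_g v g * \sum_x w (g^-1 ^ x)%g.
Proof.
under eq_bigr do rewrite mulr_sumr.
rewrite exchange_big /= [RHS](reindex (@enum_val gT gT)) /=; last first.
  by apply: onW_bij; exact: enum_val_bij.
apply: eq_bigr => i _; rewrite mxE -mulrA grME; apply: eq_bigr => g _.
by rewrite gr_ofMl conjgE.
Qed.

(** The partial augmentation of [v] at the class of [g]. *)
Definition eps v g := \sum_(h in (g ^: [set: gT])%g) v h.

Lemma eps_conj v g x : eps v (g ^ x)%g = eps v g.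
Proof. by rewrite /eps classGidl ?inE. Qed.

Lemma cent1_conj g x : (x \in 'C[g]%g) = ((g ^ x)%g == g).
Proof.
apply/cent1P/eqP => [xg|gx]; first by rewrite conjgE -xg mulKg.
by rewrite /commute -{1}gx conjgE mulKVg.
Qed.

Lemma sum_conj v g : \sum_x v (g ^ x)%g = eps v g *+ #|'C[g]%g|.
Proof.
rewrite (partition_big (fun x => g ^ x)%g (mem (g ^: [set: gT])%g)) /=; last first.
  by move=> x _; rewrite memJ_class ?inE.
rewrite /eps -sumrMnl; apply: eq_bigr => _ /imsetP[y _ ->].
rewrite (eq_bigr (fun=> v (g ^ y)%g)) => [|x /eqP-> //]; rewrite sumr_const; congr (_ *+ _).
rewrite -(card_rcoset 'C[g]%g y); apply: eq_card => x; rewrite mem_rcoset unfold_in.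
rewrite [LHS]/((g ^ x)%g == (g ^ y)%g) cent1_conj.
by rewrite conjgM (can2_eq (conjgKV y) (conjgK y)).
Qed.
End GroupRingMatrix.

Section GroupRingMatrixMap.
Variables (R S : comNzRingType) (f : {rmorphism R -> S}) (gT : finGroupType).

Lemma map_gr_mx (v w : groupRing R gT) :
  map_mx f (gr_mx v w) = gr_mx (gr_map f v) (gr_map f w).
Proof.
apply/matrixP => i j; rewrite !mxE -(gr_map_of f) -!rmorphM /=.
by rewrite /gr_map gr_funE.
Qed.

Lemma eps_map (v : groupRing R gT) g : eps (gr_map f v) g = f (eps v g).
Proof. by rewrite rmorph_sum; apply: eq_bigr => h _; rewrite gr_funE. Qed.
End GroupRingMatrixMap.

Section TorsionUnits.
Variable gT : finGroupType.
Implicit Types (u v w : groupRing int gT) (g h z x : gT).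

(** The map x -> v x g^-1 turns partial augmentations into traces; this is what makes eigenvalue
    arguments available for them. *)
Lemma trace_gr_mx_of (R : comNzRingType) (v : groupRing R gT) g :
  \tr (gr_mx v (gr_of R g^-1)%g) = eps v g *+ #|'C[g]%g|.
Proof.
rewrite trace_gr_mx -sum_conj.
under eq_bigr do rewrite mulr_sumr.
rewrite exchange_big (reindex_inj invg_inj) /=; apply: eq_bigr => x _.
rewrite (bigD1 (g ^ x)%g) //= big1 ?addr0 => [|h /negPf hgx].
  by rewrite gr_ofE -conjVg -conjgM mulgV conjg1 eqxx mulr1.
rewrite gr_ofE conjVg (inj_eq invg_inj) (can2_eq (conjgKV x) (conjgK x)).
by rewrite hgx mulr0.
Qed.

Lemma unit_gr_of (R : comNzRingType) x : gr_of R x * gr_of R x^-1%g = 1.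
Proof. by rewrite -gr_ofM mulgV gr_of1. Qed.

(* Berman-Higman: compare the trace of left multiplication by z^-1 u on CG,   *)
(* which is |G| times the coefficient of u at z, with the degree.             *)
Lemma central_coef u n z : (0 < n)%N -> u ^+ n = 1 -> z \in 'Z([set: gT])%g ->
  u z != 0 -> u = gr_of int z \/ u = - gr_of int z.
Proof.
move=> n_gt0 un cz uz; pose v := gr_of int z^-1%g * u.
have v1: v 1%g = u z by rewrite gr_ofMl invgK mulg1.
have cz' : z^-1%g \in 'Z([set: gT])%g by rewrite groupV.
have vk k : v ^+ k = gr_of int (z^-1 ^+ k)%g * u ^+ k.
  elim: k => [|k IHk]; first by rewrite !expr0 expg0 gr_of1 mulr1.
  rewrite exprSr IHk /v expgSr gr_ofM exprSr !mulrA; congr (_ * _).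
  by rewrite -mulrA -gr_of_central // mulrA.
pose A := map_mx (intr : int -> algC) (gr_mx v 1).
have AN : A ^+ (#[z]%g * n) = 1.
  rewrite /A -rmorphXn gr_mxX expr1n vk exprM.
  have -> : (u ^+ #[z]%g) ^+ n = 1 by rewrite exprAC un expr1n.
  by rewrite mulr1 expgM expVgn expg_order invg1 expg1n gr_of1 gr_mx1 rmorph1.
have N_gt0 : (0 < #[z]%g * n)%N by rewrite muln_gt0 order_gt0.
have trA : \tr A = (u z)%:~R * #|gT|%:R.
  have Dv1 : gr_mx v 1 = gr_mx v (gr_of int 1^-1%g) by rewrite invg1 gr_of1.
  rewrite trace_map_mx Dv1 trace_gr_mx_of.
  rewrite cent11T cardsT /= rmorphMn /= /eps class1G big_set1 v1 mulr_natr.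
  by [].
have G_gt0 : (0 : algC) < #|gT|%:R by rewrite ltr0n -cardsT cardG_gt0.
have := finite_order_trace_le N_gt0 AN; rewrite trA normrM normr_nat.
rewrite ger_pMl // -intr_norm -[1]/(1%:~R) ler_int => le_uz1.
have uz1 : `|u z| = 1 by apply/eqP; rewrite eq_le le_uz1; lia.
have [|a DA] := finite_order_trace_max N_gt0 AN.
  by rewrite trA normrM normr_nat -intr_norm uz1 mul1r.
have v0 h : h != 1%g -> v h = 0.
  move=> h1; apply/eqP; rewrite -(intr_eq0 algC).
  have /matrixP/(_ (enum_rank 1%g) (enum_rank h)) := DA; rewrite !mxE !enum_rankK.
  rewrite gr_of1 !mulr1 => ->; rewrite (inj_eq enum_rank_inj) (eq_sym _ h) (negPf h1).
  by rewrite mulr0n.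
have Dv : v = v 1%g *: 1.
  apply: groupRingP => h; rewrite grZE -[1]/(gr_of int 1%g) gr_ofE.
  by case: eqP => [->|/eqP/v0 ->]; rewrite ?mulr1 ?mulr0.
have Du : u = v 1%g *: gr_of int z.
  by rewrite -[LHS]mul1r -(unit_gr_of int z) -mulrA -/v {1}Dv -scalerAr mulr1.
rewrite Du v1; have [->|->] : u z = 1 \/ u z = -1 by lia.
  by left; rewrite scale1r.
by right; rewrite scaleN1r.
Qed.

Lemma eps_central (R : nmodType) z (v : gT -> R) : z \in 'Z([set: gT])%g ->
  \sum_(h in (z ^: [set: gT])%g) v h = v z.
Proof.
move=> /centerP[_ cz]; rewrite (_ : z ^: _ = [set z])%g ?big_set1 //.
apply/setP=> h; rewrite inE; apply/imsetP/eqP => [[y _ ->]|->].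
  by rewrite conjgE cz ?inE // mulKg.
by exists 1%g; rewrite ?inE // conjg1.
Qed.

(** The minor on representatives of the left cosets is the identity. *)
Lemma coset_relation_rank (F : fieldType) (H : {group gT}) :
  (#|[set: gT]| <= #|H| * \rank (\matrix_(i < #|gT|, j < #|gT|)
      ((enum_val i)^-1 * enum_val j \in H)%g%:R : 'M[F]_#|gT|))%N.
Proof.
rewrite -(Lagrange (subsetT H)) leq_pmul2l ?cardG_gt0 // -card_lcosets.
pose f (c : 'I_#|lcosets H [set: gT]|) := enum_rank (repr (enum_val c)).
apply: (@unit_minor_rank _ _ _ _ _ f f).
rewrite (_ : mxsub f f _ = 1%:M) ?unitmx1 //.
apply/matrixP => a b; rewrite !mxE !enum_rankK; congr _%:R.
have /imsetP[x _ Dx] := enum_valP a; have /imsetP[y _ Dy] := enum_valP b.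
have DxH : (repr (enum_val a) *: H = enum_val a)%g.
  by rewrite Dx lcosetE; apply/lcoset_eqP/(mem_repr x)/lcoset_refl.
have DyH : (repr (enum_val b) *: H = enum_val b)%g.
  by rewrite Dy lcosetE; apply/lcoset_eqP/(mem_repr y)/lcoset_refl.
congr nat_of_bool.
rewrite -mem_lcoset -(inj_eq enum_val_inj) [RHS]eq_sym -[in RHS]DxH -[in RHS]DyH.
exact: (sameP lcoset_eqP eqP).
Qed.

(* The bimodule argument of Hertweck: (u, g^-1) acts on ZG by x |-> u x g^-1  *)
(* with trace |C(g)| eps_g(u), and the k-th power of this map is a right      *)
(* translation.                                                               *)
Lemma eps_power_central u k z g : (0 < k)%N -> z \in 'Z([set: gT])%g ->
  u ^+ k = gr_of int z -> eps u g != 0 -> (g ^+ k)%g = z.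
Proof.
move=> k_gt0 cz uk; apply: contraNeq => gk_z.
pose y := (z * g ^- k)%g.
have y1 : y != 1%g by rewrite /y -eq_mulgV1 eq_sym.
have y_gt1 : (1 < #[y]%g)%N by rewrite order_gt1.
pose p := pdiv #[y]%g; have p_pr : prime p := pdiv_prime y_gt1.
pose A := gr_mx u (gr_of int g^-1%g).
have Akj j : A ^+ (k * j) = gr_mx 1 (gr_of int (y ^+ j)%g).
  have Ak : A ^+ k = gr_mx 1 (gr_of int y).
    by rewrite /A gr_mxX uk -gr_ofX gr_mx_central // -gr_ofM expVgn.
  by rewrite exprM Ak gr_mxX expr1n gr_ofX.
pose N := (k * #[y]%g)%N.
have N_gt0 : (0 < N)%N by rewrite muln_gt0 k_gt0 order_gt0.
have pN : (p %| N)%N by rewrite dvdn_mull // pdiv_dvd.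
have [K p'K DN] := pfactor_coprime p_pr N_gt0.
have [c Dc] : exists c, logn p N = c.+1.
  by exists (logn p N).-1; rewrite prednK // logn_gt0 mem_primes p_pr N_gt0.
have K_gt0 : (0 < K)%N by move: N_gt0; rewrite DN muln_gt0 => /andP[].
have DNp : (p ^ c * K = k * (#[y]%g %/ p))%N.
  apply/eqP; rewrite -(eqn_pmul2r (prime_gt0 p_pr)) -[eqbRHS]mulnA.
  by rewrite divnK ?pdiv_dvd // -/N DN Dc expnSr mulnA (mulnC K).
suffices trA : \tr A = 0.
  move: trA; rewrite trace_gr_mx_of => /eqP; rewrite mulrn_eq0.
  by rewrite (negPf (lt0n_neq0 (cardG_gt0 _))).
apply: (@free_trace_eq0 p c K) => //; first by rewrite -prime_coprime.
  by rewrite mulnC -Dc -DN Akj expg_order gr_of1 gr_mx1.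
have {1}-> : #|gT| = #|[set: gT]| by rewrite cardsT.
have y_p : #[(y ^+ (#[y] %/ p))%g]%g = p.
  by rewrite orderXdiv ?dvdn_div ?pdiv_dvd // divnA ?pdiv_dvd // mulKn ?order_gt0.
set y' := (y ^+ _)%g in y_p; rewrite -{1}y_p.
apply: leq_trans (coset_relation_rank 'F_p <[y']>) _.
rewrite leq_pmul2l ?order_gt0 //; apply: eq_leq; congr (\rank _).
(* Modulo p, (T - 1)^(p-1) = 1 + T + ... + T^(p-1). For T the right translation by y', of order [p],
   this sum is the coset relation matrix of the subgroup generated by y'. *)
rewrite DNp Akj -/y' rmorphB rmorph1 expr_sub1_pred_pchar ?pchar_Fp //.
rewrite /= map_gr_mx rmorph1 gr_map_of.
under eq_bigr do rewrite gr_mxX expr1n -gr_ofX gr_mx1_of.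
apply/matrixP => i j; rewrite summxE mxE.
under eq_bigr do rewrite mxE.
rewrite -natr_sum; congr _%:R.
case: (boolP (_ \in _)) => [/cyclePmin[m m_lt Dm]|not_y].
  rewrite y_p in m_lt; rewrite (bigD1 (Ordinal m_lt)) //= -Dm mulKVg eqxx big1 // => l lm.
  case: eqP => // Dj; have /eqP: (y' ^+ m = y' ^+ l)%g by rewrite -Dm Dj mulKg.
  rewrite eq_expg_mod_order y_p !modn_small // => /eqP Dl.
  by case/eqP: lm; apply: val_inj.
rewrite big1 // => l _; case: eqP => // Dj; case/negP: not_y.
by rewrite Dj mulKg mem_cycle.
Qed.
End TorsionUnits.

(** * Powers and trace bounds *)

Section RotationSum.
Variables (gT : finGroupType) (p : nat) (W : p.-tuple gT -> 'F_p).
Hypotheses (p_pr : prime p) (W_rot : forall t : p.-tuple gT, W [tuple of rot 1 t] = W t).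

Lemma iter_rot1 (T : Type) k (s : seq T) :
  (k <= size s)%N -> iter k (rot 1) s = rot k s.
Proof.
elim: k => [|k IHk] ks; first by rewrite rot0.
by rewrite iterS IHk ?(ltnW ks) // [RHS]rotS.
Qed.

Lemma rot1_constant (T : Type) (x : T) s : rcons s x = x :: s -> s = nseq (size s) x.
Proof. by elim: s => //= y s IHs [-> /IHs {1}->]. Qed.

(** Rotation generates a group of order 1 or p, so modulo p each level set of [W] has as many
    elements as it has constant tuples. *)
Lemma sum_rotation_invariant : \sum_t W t = \sum_h W [tuple of nseq p h].
Proof.
have rot_inj : injective (fun t : p.-tuple gT => [tuple of rot 1 t]).
  by move=> t t' /(congr1 val)/= /rot_inj/val_inj.
pose s := perm rot_inj.
have sk k t : (k <= p)%N -> tval ((s ^+ k)%g t) = rot k t.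
  move=> kp; rewrite -iter_rot1 ?size_tuple // permX.
  by elim: k {kp} => //= k <-; rewrite permE.
have sp : (s ^+ p)%g = 1%g.
  by apply/permP => t; apply: val_inj; rewrite /= sk // perm1 rot_oversize ?size_tuple.
have pS : (p.-group <[s]>)%g.
  have [_ /(_ #[s]%g)] := primeP p_pr; rewrite order_dvdn sp eqxx => /(_ isT)/pred2P[] s_p.
    by rewrite /pgroup -orderE s_p.
  by rewrite /pgroup -orderE s_p pnat_id.
pose S v := [set t | W t == v].
have actS v : [acts <[s]>, on S v | 'P]%g.
  rewrite cycle_subG; apply/astabsP => t; rewrite /= !inE /aperm permE.
  by rewrite W_rot.
have fixS v : #|S v|%:R = #|[set t in S v | [tuple of rot 1 t] == t]|%:R :> 'F_p.
  rewrite -(Fp_nat_mod p_pr) (pgroup_fix_mod pS (actS v)) (Fp_nat_mod p_pr) afix_cycle.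
  congr _%:R; apply: eq_card => t; rewrite !inE; congr andb.
  by rewrite sub1set inE /= /aperm permE.
have sumW (A : {set p.-tuple gT}) :
    \sum_(t in A) W t = \sum_v v * #|[set t in A | W t == v]|%:R.
  rewrite (partition_big W xpredT) //=; apply: eq_bigr => v _.
  rewrite (eq_bigr (fun=> v)) => [|t /andP[_ /eqP] //]; rewrite sumr_const mulr_natr.
  by congr (_ *+ _); apply: eq_card => t; rewrite !inE.
transitivity (\sum_(t in [set t : p.-tuple gT | [tuple of rot 1 t] == t]) W t).
  transitivity (\sum_(t in [set: p.-tuple gT]) W t); first by apply: eq_bigl => t; rewrite inE.
  rewrite !sumW; apply: eq_bigr => v _; congr (_ * _).
  transitivity (#|S v|%:R : 'F_p).
    by congr _%:R; apply: eq_card => t; rewrite !inE.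
  by rewrite fixS; congr _%:R; apply: eq_card => t; rewrite !inE andbC.
have p_gt0 := prime_gt0 p_pr.
rewrite (reindex (fun h => [tuple of nseq p h])) /=.
  apply: eq_bigl => h; rewrite inE; apply/eqP/val_inj => /=.
  by case: (p) => //= p'; rewrite rot1_cons; elim: p' => //= n ->.
exists (fun t : p.-tuple gT => head 1%g t) => [h _|t].
  by rewrite /= -(prednK p_gt0).
rewrite inE => /eqP/(congr1 val)/= t1; apply: val_inj => /=.
have := size_tuple t; case: (tval t) t1 => [|x s'] /=; first by move/esym; lia.
by rewrite rot1_cons => s's sz_s; rewrite (rot1_constant s's) -[in LHS]sz_s.
Qed.
End RotationSum.

Lemma gr_exp_coef (R : comNzRingType) (gT : finGroupType) (v : groupRing R gT) m g :
  (v ^+ m) g = \sum_(t : m.-tuple gT | (\prod_(x <- t) x)%g == g) \prod_(x <- t) v x.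
Proof.
elim: m g => [|m IHm] g.
  rewrite expr0 -gr_of1 gr_ofE; case: eqP => [->|g1].
    rewrite (big_pred1 [tuple]) ?big_nil // => t.
    by rewrite [t]tuple0 big_nil !eqxx.
  rewrite big_pred0 // => t; rewrite [t]tuple0 big_nil; apply/eqP => /esym.
  by move/g1.
rewrite exprS grME; under eq_bigr do rewrite IHm mulr_sumr.
rewrite pair_big_dep /= (reindex (fun xt : gT * m.-tuple gT => cons_tuple xt.1 xt.2)) /=.
  apply: eq_big => [[x t]|[x t] _] /=; last by rewrite big_cons.
  by rewrite big_cons (can2_eq (mulKg x) (mulKVg x)).
exists (fun t => (thead t, behead_tuple t)) => [[x t] _|t _] /=.
  by congr pair; apply: val_inj.
by rewrite [RHS]tuple_eta; apply: val_inj.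
Qed.

(** Expand v^p over p-tuples: rotating a tuple conjugates its product, so only constant tuples
    survive, and v(h)^p = v(h) in F_p. *)
Lemma eps_expp (gT : finGroupType) p (v : groupRing 'F_p gT) g : prime p ->
  eps (v ^+ p) g = \sum_(h | ((h ^+ p)%g \in (g ^: [set: gT])%g)) v h.
Proof.
move=> p_pr; pose C := (g ^: [set: gT])%g.
pose W (t : p.-tuple gT) : 'F_p :=
  if (\prod_(x <- t) x)%g \in C then \prod_(x <- t) v x else 0.
have -> : eps (v ^+ p) g = \sum_t W t.
  rewrite /eps -[RHS]big_mkcond /=.
  rewrite (partition_big (fun t : p.-tuple gT => \prod_(x <- t) x)%g (mem C)) //=.
  apply: eq_bigr => h Ch; rewrite gr_exp_coef; apply: eq_bigl => t.
  by case: eqP => [->|_]; rewrite ?andbT ?andbF.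
rewrite sum_rotation_invariant // => [|t].
  rewrite [RHS]big_mkcond; apply: eq_bigr => h _; rewrite /W.
  rewrite !big_nseq iter_mulr_1.
  have -> : v h ^+ p = v h by have := expf_card (v h); rewrite card_Fp.
  by congr (if _ \in C then _ else _); elim: (p) => //= k ->; rewrite expgS.
rewrite /W; have -> : \prod_(x <- rot 1 t) v x = \prod_(x <- t) v x.
  by apply: perm_big; rewrite perm_rot.
rewrite /=; congr (if _ then _ else _); case: (tval t) => [|x s] //.
rewrite rot1_cons -cats1 big_cat big_seq1 big_cons /=.
have -> : (\prod_(i <- s) i * x = (x * \prod_(i <- s) i) ^ x)%g.
  by rewrite conjgE mulgA mulKg.
by rewrite memJ_norm // (subsetP (class_norm _ _)) ?inE.
Qed.

Lemma eps_expp_modp (gT : finGroupType) p (u : groupRing int gT) g : prime p ->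
  (eps (u ^+ p) g)%:~R =
  (\sum_(h | ((h ^+ p)%g \in (g ^: [set: gT])%g)) u h)%:~R :> 'F_p.
Proof.
move=> p_pr; rewrite -[LHS](eps_map (intr : {rmorphism int -> 'F_p})) rmorphXn /= eps_expp //.
by rewrite rmorph_sum; apply: eq_bigr => h _; rewrite gr_funE.
Qed.

Section TraceBounds.
Variable gT : finGroupType.
Implicit Types (u v w : groupRing int gT) (g h z x : gT).

Lemma cent1V g : 'C[g^-1]%g = 'C[g]%g.
Proof. by apply/setP => x; rewrite !cent1_conj conjVg (inj_eq invg_inj). Qed.

(** The inverse of a matrix of finite order has the conjugate trace, and the traces here are
    integers. Note that u^n is the inverse of [u]. *)
Lemma eps_inv u n g : u ^+ n.+1 = 1 -> eps (u ^+ n) g^-1%g = eps u g.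
Proof.
move=> un; pose A := map_mx (intr : int -> algC) (gr_mx u (gr_of int g^-1%g)).
pose B := map_mx (intr : int -> algC) (gr_mx (u ^+ n) (gr_of int g)).
have AB : A *m B = 1.
  rewrite -map_mxM gr_mxM -exprSr un -gr_ofM mulVg gr_of1 gr_mx1; exact: rmorph1.
have N_gt0 : (0 < n.+1 * #[g]%g)%N by rewrite muln_gt0 order_gt0.
have AN : A ^+ (n.+1 * #[g]%g) = 1.
  rewrite /A -rmorphXn gr_mxX -gr_ofX exprM un expr1n mulnC expgM expVgn.
  by rewrite expg_order invg1 expg1n gr_of1 gr_mx1 rmorph1.
have := finite_order_trace_inv N_gt0 AN AB; rewrite !trace_map_mx.
rewrite -[g in gr_mx (u ^+ n) (gr_of int g)]invgK !trace_gr_mx_of.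
rewrite cent1V /= rmorph_int => /intr_inj.
exact: (pmulrnI (cardG_gt0 _)).
Qed.

Lemma trace_conj_mx u v n : u ^+ n.+1 = 1 ->
  \tr (gr_mx v (u ^+ n)) = \sum_g v g * (eps u g *+ #|'C[g]%g|).
Proof.
move=> un; rewrite trace_gr_mx; apply: eq_bigr => g _; congr (_ * _).
by rewrite sum_conj eps_inv // cent1V.
Qed.

Lemma conj_mxX u n : u ^+ n.+1 = 1 -> gr_mx u (u ^+ n) ^+ n.+1 = 1.
Proof. by move=> un; rewrite gr_mxX un exprAC un expr1n gr_mx1. Qed.

(** The left side is the trace of conjugation by [u], of finite order on a space of dimension |G|.
    Grouped by classes, it is the sum of |C(g)| times the squared partial augmentation. *)
Lemma eps_norm_bound u n : (0 < n)%N -> u ^+ n = 1 ->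
  \sum_g u g * (eps u g *+ #|'C[g]%g|) <= #|gT|%:R.
Proof.
case: n => // n _ un; rewrite -(trace_conj_mx _ un).
pose A := map_mx (intr : int -> algC) (gr_mx u (u ^+ n)).
have AN : A ^+ n.+1 = 1 by rewrite /A -rmorphXn conj_mxX ?rmorph1.
have := finite_order_trace_le (ltn0Sn n) AN; rewrite trace_map_mx /= -intr_norm.
rewrite -(ler_int algC) [#|_|%:R%:~R]rmorph_nat; apply: le_trans.
by rewrite ler_int ler_norm.
Qed.

(* The previous bound on the summand CG(1-z)/2 of CG. *)
Lemma eps_odd_norm_bound u n z : (0 < n)%N -> u ^+ n = 1 ->
    z \in 'Z([set: gT])%g -> (z ^+ 2 = 1)%g -> z != 1%g ->
  \sum_g (u g - u (z * g)%g) * (eps u g *+ #|'C[g]%g|) <= #|gT|%:R.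
Proof.
case: n => // n _ un cz z2 z1; have zV : (z^-1 = z)%g.
  by apply/eqP; rewrite eq_invg_mul -expg2 z2.
have -> : \sum_g (u g - u (z * g)%g) * (eps u g *+ #|'C[g]%g|) =
          \tr (gr_mx u (u ^+ n)) - \tr (gr_mx (gr_of int z * u) (u ^+ n)).
  rewrite !trace_conj_mx // -sumrB; apply: eq_bigr => g _.
  by rewrite gr_ofMl zV mulrBl.
pose f (A : 'M[int]_#|gT|) : 'M[algC]_#|gT| := map_mx intr A.
pose S := f (gr_mx u (u ^+ n)); pose Z := f (gr_mx (gr_of int z) 1).
pose E : 'M_#|gT| := 2^-1 *: (1 - Z).
have SZ : S * Z = f (gr_mx (gr_of int z * u) (u ^+ n)).
  by rewrite -mulmxE -[LHS]map_mxM gr_mxM mulr1.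
have ZS : Z * S = S * Z.
  by rewrite SZ -mulmxE -[LHS]map_mxM gr_mxM mul1r gr_of_central.
have ZZ : Z * Z = 1.
  rewrite -mulmxE -[LHS]map_mxM gr_mxM mulr1 -gr_ofM -expg2 z2 gr_of1 gr_mx1.
  exact: rmorph1.
have EE : E * E = E.
  have ZZ2 : (1 - Z) * (1 - Z) = 2 *: (1 - Z).
    by rewrite mulrBl mul1r mulrBr ZZ mulr1 opprB scaler_nat mulr2n.
  by rewrite /E -mulmxE -scalemxAl -scalemxAr mulmxE ZZ2 !scalerA; congr (_ *: _); field.
have ES : E * S = S * E.
  by rewrite /E -!mulmxE -scalemxAl -scalemxAr !mulmxE mulrBl mulrBr ZS mul1r mulr1.
have [F DF] : exists F : 'M[algC]_#|gT|, F = 1 - E by exists (1 - E).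
(* Conjugation by [u] on the image of the idempotent [E], identity on its complement: again of
   finite order, so its trace is at most |G|, of which the complement contributes |G|/2. *)
pose T := S * E + F.
have EF : E * F = 0 by rewrite DF mulrBr mulr1 EE subrr.
have FE : F * E = 0 by rewrite DF mulrBl mul1r EE subrr.
have FF : F * F = F by rewrite {1}DF mulrBl mul1r EF subr0.
have Tk k : T ^+ k = S ^+ k * E + F.
  elim: k => [|k IHk]; first by rewrite !expr0 mul1r DF addrC subrK.
  rewrite exprSr IHk /T mulrDl !mulrDr -!mulrA EF mulr0 addr0 FF.
  have -> : E * (S * E) = S * E by rewrite mulrA ES -mulrA EE.
  by rewrite -ES (mulrA F) FE mul0r add0r ES mulrA -exprSr.
have TN : T ^+ n.+1 = 1.
  by rewrite Tk /S /f -rmorphXn conj_mxX // rmorph1 mul1r DF addrC subrK.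
have trZ : \tr Z = 0.
  rewrite /Z trace_map_mx -(gr_of1 int) -invg1 trace_gr_mx_of /eps class1G big_set1.
  by rewrite gr_ofE eq_sym (negPf z1) mul0rn rmorph0.
have trE : \tr E = #|gT|%:R / 2.
  by rewrite /E mxtraceZ raddfB /= mxtrace1 trZ subr0 mulrC.
have trSE : \tr (S * E) = (\tr S - \tr (S * Z)) / 2.
  by rewrite /E -!mulmxE -scalemxAr mxtraceZ !mulmxE mulrBr mulr1 raddfB mulrC.
have := finite_order_trace_le (ltn0Sn n) TN.
rewrite /T DF raddfD raddfB /= mxtrace1 trE trSE SZ /S !trace_map_mx /=.
rewrite -rmorphB /=; set t := (_ - _ in X in X -> _); move=> le_t.
have {le_t}: (t%:~R / 2 + (#|gT|%:R - #|gT|%:R / 2) : algC) <= #|gT|%:R.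
  apply: le_trans le_t; apply: real_ler_norm.
  by rewrite !rpredD ?rpredN ?rpred_div ?rpred_nat ?Rreal_int.
rewrite -(ler_int algC) [#|_|%:R%:~R]rmorph_nat => le_t.
have -> : #|gT|%:R = 2 * (#|gT|%:R - (#|gT|%:R - #|gT|%:R / 2)) :> algC by field.
by rewrite -ler_pdivrMl ?ltr0n // mulrC lerBrDr.
Qed.
End TraceBounds.

(** * Conjugacy in the rational group ring *)

Section RationalConjugacy.

Lemma nonroot_nat (R : numDomainType) (q : {poly R}) : q != 0 ->
  exists j : nat, ~~ root q j%:R.
Proof.
move=> q0; pose s := [seq j%:R : R | j <- iota 0 (size q)].
have us : uniq s.
  rewrite map_inj_uniq ?iota_uniq // => i j /eqP; rewrite eqr_nat.
  by move/eqP.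
have [/(max_poly_roots q0)/(_ us)|/allPn[_ /mapP[j _ ->]]] := boolP (all (root q) s).
  by rewrite size_map size_iota ltnn.
by exists j.
Qed.

(* The coefficients are replaced one at a time by natural numbers avoiding    *)
(* the roots of a determinant.                                                *)
Lemma rational_unit_combination m n (N : 'I_m -> 'M[rat]_n) (c : 'I_m -> algC) :
  \sum_i c i *: map_mx ratr (N i) \in unitmx ->
  exists q : 'I_m -> rat, \sum_i q i *: N i \in unitmx.
Proof.
pose M (c : 'I_m -> algC) := \sum_i c i *: map_mx (ratr : rat -> algC) (N i).
rewrite -/(M c) => Mc.
have step k : (k <= m)%N -> exists c' : 'I_m -> algC, exists2 q : 'I_m -> rat,
    forall i : 'I_m, (i < k)%N -> c' i = ratr (q i) & M c' \in unitmx; last first.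
  have [c' [q cq]] := step m (leqnn m).
  move=> Mc'; exists q; rewrite -(map_unitmx (ratr : {rmorphism rat -> algC})).
  suff <- : M c' = map_mx (ratr : {rmorphism rat -> algC}) (\sum_i q i *: N i) by [].
  rewrite raddf_sum; apply: eq_bigr => i _.
  by rewrite /= map_mxZ cq.
elim: k => [|k IHk] km.
  by exists c, (fun=> 0).
have [c' [q cq Mc']] := IHk (ltnW km); pose i0 := Ordinal km.
pose A := \sum_(i | i != i0) c' i *: map_mx (ratr : rat -> algC) (N i).
pose B := map_mx (ratr : rat -> algC) (N i0).
pose f := \det (map_mx polyC A + 'X *: map_mx polyC B).
have fE t : f.[t] = \det (A + t *: B).
  rewrite -horner_evalE -det_map_mx; congr (\det _); apply/matrixP => i j.
  by rewrite !mxE /= horner_evalE !hornerE.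
have [|j fj] := @nonroot_nat _ f.
  apply/eqP => f0; move: Mc'; rewrite unitmxE unitfE /M (bigD1 i0) //= addrC -fE.
  by rewrite f0 horner0 eqxx.
exists (fun i => if i == i0 then j%:R else c' i).
exists (fun i => if i == i0 then j%:R else q i) => [i|].
  rewrite ltnS leq_eqVlt -[(i : nat) == k]/(i == i0).
  by case: eqP => [_ _|_ /cq //]; rewrite ratr_nat.
rewrite unitmxE unitfE /M (bigD1 i0) //= eqxx addrC.
rewrite (eq_bigr (fun i => c' i *: map_mx ratr (N i))) => [|i /negPf-> //].
by rewrite -fE.
Qed.

Variable gT : finGroupType.

Lemma gr_rowMmx (R : comNzRingType) (x v w : groupRing R gT) :
  gr_row x *m gr_mx v w = gr_row (v * x * w).
Proof.
apply/rowP => j; rewrite !mxE; under eq_bigr do rewrite !mxE.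
rewrite -(reindex (@enum_val gT gT) (P := xpredT)
  (F := fun y => x y * (v * gr_of R y * w) (enum_val j))) /=; last first.
  by apply: onW_bij; exact: enum_val_bij.
rewrite [in RHS](gr_sum x) mulr_sumr mulr_suml gr_sumE; apply: eq_bigr => y _.
by rewrite -scalerAr -scalerAl grZE.
Qed.

Lemma gr_row_inj (R : nzRingType) : injective (@gr_row R gT).
Proof.
move=> v w vw; apply: groupRingP => g.
by move/rowP/(_ (enum_rank g)): vw; rewrite !mxE enum_rankK.
Qed.

Lemma gr_row_surj (R : nzRingType) (r : 'rV[R]_#|gT|) : exists v, gr_row v = r.
Proof.
exists (gr_fun (fun g => r 0 (enum_rank g))); apply/rowP => i.
by rewrite mxE gr_funE enum_valK.
Qed.

Lemma gr_mx_unit (F : fieldType) (w : groupRing F gT) :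
  gr_mx w 1 \in unitmx -> w \is a GRing.unit.
Proof.
move=> wu; have [x Dx] := gr_row_surj (gr_row (1 : groupRing F gT) *m invmx (gr_mx w 1)).
have wx : w * x = 1.
  by apply: gr_row_inj; rewrite -[w * x]mulr1 -gr_rowMmx Dx mulmxKV.
apply/unitrP; exists x; split=> //.
have := gr_mxM x 1 w 1; rewrite wx mulr1 gr_mx1 => /mulmx1C.
rewrite gr_mxM mulr1 -[1%:M]gr_mx1 => /(congr1 (mulmx (gr_row 1))).
by rewrite !gr_rowMmx !mulr1 => /gr_row_inj.
Qed.

Section Representation.
Variables (m : nat) (v : groupRing algC gT).
Hypotheses (m_gt1 : (1 < m)%N) (vm : v ^+ m = 1).

(** CG as a module over the product of a cyclic group, acting through powers of [v] on the left, and
    G, acting on the right. *)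
Definition unit_repr_mx (x : 'Z_m * gT) := gr_mx (v ^+ x.1) (gr_of algC x.2).

Lemma unit_repr_subproof : mx_repr [set: 'Z_m * gT] unit_repr_mx.
Proof.
split=> [|[a x] [b y] _ _]; first by rewrite /unit_repr_mx /= expr0 gr_of1 gr_mx1.
rewrite /unit_repr_mx /= gr_mxM -gr_ofM -exprD; congr gr_mx.
have vm' : v ^+ (Zp_trunc m).+2 = 1 by rewrite Zp_cast.
by rewrite (expr_mod _ vm') addnC.
Qed.

Canonical unit_repr := MxRepresentation unit_repr_subproof.
End Representation.

(* CG, with u acting on the left and G on the right, has character            *)
(* |C(h)| eps_h(u^i), so it is isomorphic to the same module for g.           *)
Lemma eps_conjugate (u : groupRing int gT) g n : (0 < n)%N -> u ^+ n = 1 ->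
    (forall i h, eps (u ^+ i) h = eps (gr_of int g ^+ i) h) ->
  exists2 x : groupRing rat gT, x \is a GRing.unit &
    x^-1 * gr_map (intr : int -> rat) u * x = gr_of rat g.
Proof.
move=> n_gt0 un eps_ug.
have [m m_gt1 [um gm]] : exists2 m, (1 < m)%N & u ^+ m = 1 /\ (g ^+ m = 1)%g.
  exists (n * 2 * #[g]%g)%N; first by have := order_gt0 g; nia.
  split; first by rewrite -mulnA exprM un expr1n.
  by rewrite mulnC expgM expg_order expg1n.
pose C := (intr : {rmorphism int -> algC}); pose Q := (intr : {rmorphism int -> rat}).
pose uC := gr_map C u; pose gC := gr_of algC g.
have uCm : uC ^+ m = 1 by rewrite -rmorphXn um rmorph1.
have gCm : gC ^+ m = 1 by rewrite -gr_ofX gm gr_of1.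
have /cfRepr_rsimP[B _ Bfree BP] : cfRepr (unit_repr m_gt1 uCm) == cfRepr (unit_repr m_gt1 gCm).
  apply/eqP/cfunP => -[a x]; rewrite !cfunE !inE /= /unit_repr_mx /=.
  rewrite -[x]invgK !trace_gr_mx_of /uC /gC -(gr_map_of C) -!rmorphXn !eps_map.
  by rewrite eps_ug.
have [w Dw] := gr_row_surj (gr_row 1 *m B).
have rowE (R : comNzRingType) i : delta_mx 0 i = gr_row (gr_of R (enum_val i : gT)).
  by apply/rowP => j; rewrite !mxE gr_ofE (inj_eq enum_val_inj).
(* An intertwiner for right translations is left multiplication by the image [w] of 1. *)
have DB : B = gr_mx w 1.
  apply/row_matrixP => i; rewrite !matrix.rowE !rowE gr_rowMmx mulr1.
  have := BP (1%g, enum_val i) (in_setT _); rewrite /= /unit_repr_mx /= !expr0.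
  move=> /(congr1 (mulmx (gr_row 1))); rewrite !mulmxA gr_rowMmx !mul1r => ->.
  by rewrite -Dw gr_rowMmx mul1r.
have wuC : w * uC = gC * w.
  have := BP (inZp 1, 1%g) (in_setT _); rewrite /= /unit_repr_mx /= modn_small // !expr1.
  move=> /(congr1 (mulmx (gr_row 1))); rewrite !mulmxA DB !gr_rowMmx gr_of1 !mulr1.
  by move/gr_row_inj.
have Bu : gr_mx w 1 \in unitmx by rewrite -DB -row_free_unit.
(* The left kernel of [K] is the space of solutions of x u = g x. It is spanned by rational rows,
   and [w] is a complex combination of them. *)
pose K := gr_mx 1 (gr_map Q u) - gr_mx (gr_of rat g) 1.
pose w_ i : groupRing rat gT := gr_fun (fun h => kermx K i (enum_rank h)).
have Kratr : map_mx (ratr : {rmorphism rat -> algC}) K = gr_mx 1 uC - gr_mx gC 1.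
  rewrite raddfB /= !map_gr_mx rmorph1 gr_map_of; congr (gr_mx _ _ - _).
  by apply: groupRingP => h; rewrite !gr_funE; exact: ratr_int.
have [c Dc] : exists c, gr_row w = c *m map_mx (ratr : {rmorphism rat -> algC}) (kermx K).
  apply/submxP; rewrite map_kermx Kratr; apply/sub_kermxP.
  by rewrite mulmxBr !gr_rowMmx mul1r mulr1 wuC subrr.
have [q qu] : exists q, \sum_i q i *: gr_mx (w_ i) 1 \in unitmx.
  apply: (@rational_unit_combination _ _ _ (c 0)); move: Bu; congr (_ \in unitmx).
  apply/matrixP => i j; rewrite summxE !mxE mulr1 gr_ofMr.
  set h := (enum_val j * _)%g; have /rowP/(_ (enum_rank h)) := Dc.
  rewrite !mxE enum_rankK => ->; apply: eq_bigr => k _.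
  rewrite [RHS]mxE [in LHS]mxE; congr (_ * _); rewrite [RHS]mxE; congr ratr.
  by rewrite [RHS]mxE mulr1 gr_ofMr gr_funE.
pose wq := \sum_i q i *: w_ i.
have wqE : gr_mx wq 1 = \sum_i q i *: gr_mx (w_ i) 1.
  apply/matrixP => i j; rewrite summxE !mxE mulr1 gr_ofMr gr_sumE.
  by apply: eq_bigr => k _; rewrite !mxE mulr1 gr_ofMr grZE.
have wq_u : wq \is a GRing.unit by apply: gr_mx_unit; rewrite wqE.
have wquQ : wq * gr_map Q u = gr_of rat g * wq.
  have: gr_row wq *m K = 0.
    have -> : gr_row wq = \row_i q i *m kermx K.
      apply/rowP => j; rewrite !mxE gr_sumE; apply: eq_bigr => k _.
      by rewrite grZE gr_funE enum_valK mxE.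
    by rewrite -mulmxA mulmx_ker mulmx0.
  rewrite mulmxBr !gr_rowMmx mul1r mulr1 => /eqP; rewrite subr_eq0 => /eqP.
  exact: gr_row_inj.
by exists wq^-1; rewrite ?unitrV // invrK wquQ mulrK.
Qed.
End RationalConjugacy.

(** * Class functions and partial augmentations of powers *)

Section ClassSums.
Variable gT : finGroupType.
Implicit Types (u v : groupRing int gT) (g h x : gT).

Definition same_eps u g := eps u =1 eps (gr_of int g).

Lemma eps_gr_of g h : eps (gr_of int g) h = (g \in (h ^: [set: gT])%g)%:R.
Proof.
rewrite /eps; have [hg|hg] := boolP (g \in _).
  rewrite (bigD1 g) //= gr_ofE eqxx big1 ?addr0 // => x /andP[_ /negPf xg].
  by rewrite gr_ofE xg.
by rewrite big1 // => x hx; rewrite gr_ofE; case: eqP => // xg; rewrite -xg hx in hg.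
Qed.

Lemma eq_eps_sum (V : zmodType) (f : gT -> V) u v :
  (forall x y, f (x ^ y)%g = f x) -> eps u =1 eps v ->
  \sum_x f x *~ u x = \sum_x f x *~ v x.
Proof.
move=> fJ uv; have E (w : groupRing int gT) : \sum_x f x *~ w x =
    \sum_(C in classes [set: gT]) f (repr C) *~ eps w (repr C).
  rewrite (partition_big (fun x => x ^: [set: gT])%g (mem (classes [set: gT]))) /=.
    apply: eq_bigr => _ /imsetP[y _ ->].
    have [z _ Dz] := repr_class [set: gT] y; rewrite Dz fJ eps_conj.
    rewrite /eps raddf_sum; apply: eq_big => [x|x /eqP xy].
      by apply/eqP/idP => [<-|/class_eqP//]; rewrite class_refl.
    have /imsetP[t _ ->] : x \in (y ^: [set: gT])%g by rewrite -xy class_refl.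
    by rewrite fJ.
  by move=> x _; rewrite mem_classes ?inE.
by rewrite !E; apply: eq_bigr => C _; rewrite uv.
Qed.

Lemma sum_gr_of (V : zmodType) (f : gT -> V) g : \sum_x f x *~ gr_of int g x = f g.
Proof.
rewrite (bigD1 g) //= gr_ofE eqxx mulr1z big1 ?addr0 // => x /negPf xg.
by rewrite gr_ofE xg mulr0z.
Qed.

Lemma same_eps_sum (V : zmodType) (f : gT -> V) u g :
  (forall x y, f (x ^ y)%g = f x) -> same_eps u g -> \sum_x f x *~ u x = f g.
Proof. by move=> fJ ug; rewrite (eq_eps_sum fJ ug) sum_gr_of. Qed.

Lemma same_eps_conj u g h : same_eps u g -> h \in (g ^: [set: gT])%g -> same_eps u h.
Proof.
move=> ug /class_eqP hg x; rewrite ug !eps_gr_of; congr (nat_of_bool _)%:R.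
by apply/class_eqP/class_eqP; rewrite hg.
Qed.

Lemma eps_exp_prime p u g : prime p ->
  (eps (u ^+ p) g)%:~R =
  \sum_x ((x ^+ p)%g \in (g ^: [set: gT])%g)%:R *~ u x :> 'F_p.
Proof.
move=> p_pr; rewrite eps_expp_modp // rmorph_sum /= big_mkcond; apply: eq_bigr => x _.
by case: ifP => _; rewrite ?mul0rz.
Qed.

Lemma exp_class_invariant p g (x y : gT) :
  (((x ^ y) ^+ p)%g \in (g ^: [set: gT])%g) = ((x ^+ p)%g \in (g ^: [set: gT])%g).
Proof. by rewrite -conjXg memJ_norm // (subsetP (class_norm _ _)) ?inE. Qed.

(** Modulo p, the partial augmentation of u^p at [h] is both 1 and the indicator of g^p being
    conjugate to [h]. *)
Lemma same_eps_expp p u g h : prime p -> same_eps u g -> same_eps (u ^+ p) h ->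
  same_eps (u ^+ p) (g ^+ p)%g.
Proof.
move=> p_pr ug uh; apply: (same_eps_conj uh).
have := eps_exp_prime u h p_pr; rewrite uh eps_gr_of class_refl.
rewrite (same_eps_sum _ ug) => [|x y]; last by rewrite exp_class_invariant.
by case: (_ \in _) => // /eqP; rewrite oner_eq0.
Qed.

Lemma same_eps_central u n g : (0 < n)%N -> u ^+ n = 1 -> g \in 'Z([set: gT])%g ->
  same_eps u g -> u = gr_of int g.
Proof.
move=> n_gt0 un cg ug; have ug1 : u g = 1.
  have := ug g; rewrite eps_gr_of class_refl /eps.
  by rewrite (eps_central _ cg).
have [|//|uN] := central_coef n_gt0 un cg; first by rewrite ug1.
by move: ug1; rewrite uN grNE gr_ofE eqxx.
Qed.

Section RingExtension.
Variables (A : pzRingType) (rho : gT -> A).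
Hypotheses (rho1 : rho 1%g = 1) (rhoM : forall x y, rho (x * y)%g = rho x * rho y).

Definition gr_ext u : A := \sum_x rho x *~ u x.

Lemma gr_ext_of g : gr_ext (gr_of int g) = rho g.
Proof. exact: sum_gr_of. Qed.

Lemma gr_extM u v : gr_ext (u * v) = gr_ext u * gr_ext v.
Proof.
rewrite /gr_ext mulr_suml; under [RHS]eq_bigr do rewrite mulr_sumr.
under [LHS]eq_bigr do rewrite grME raddf_sum.
rewrite exchange_big; apply: eq_bigr => x _ /=.
rewrite (reindex_inj (mulgI x)); apply: eq_bigr => y _ /=.
by rewrite mulKg rhoM mulrzAl mulrzAr -mulrzA mulrC.
Qed.

Lemma gr_extX u k : gr_ext (u ^+ k) = gr_ext u ^+ k.
Proof.
elim: k => [|k IHk]; first by rewrite !expr0 -(gr_of1 int gT) gr_ext_of.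
by rewrite !exprS gr_extM IHk.
Qed.
End RingExtension.
End ClassSums.

(** * Conjugacy classes of GL(2, 5) *)

Section Matrix22.
Variable F : fieldType.
Implicit Types (A B : 'M[F]_2) (a b c d t : F).

Definition mx22 a b c d : 'M[F]_2 :=
  \matrix_(i, j) if i == 0 then (if j == 0 then a else b) else (if j == 0 then c else d).

Lemma mx22_eta A : A = mx22 (A 0 0) (A 0 1) (A 1 0) (A 1 1).
Proof.
by apply/matrixP => i j; rewrite mxE; case: i j => [[|[|]] // ?] [[|[|]] // ?];
  rewrite /=; congr (A _ _); apply: val_inj.
Qed.

Lemma eq_mx22 a b c d a' b' c' d' :
  [/\ a = a', b = b', c = c' & d = d'] -> mx22 a b c d = mx22 a' b' c' d'.
Proof. by case=> -> -> -> ->. Qed.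

Lemma mx22M a b c d a' b' c' d' : mx22 a b c d *m mx22 a' b' c' d' =
  mx22 (a * a' + b * c') (a * b' + b * d') (c * a' + d * c') (c * b' + d * d').
Proof.
by rewrite [LHS]mx22_eta !mxE !big_ord_recl !big_ord0 !mxE /= !addr0.
Qed.

Lemma mx22D a b c d a' b' c' d' :
  mx22 a b c d + mx22 a' b' c' d' = mx22 (a + a') (b + b') (c + c') (d + d').
Proof. by rewrite [LHS]mx22_eta !mxE. Qed.

Lemma mx22Z x a b c d : x *: mx22 a b c d = mx22 (x * a) (x * b) (x * c) (x * d).
Proof. by rewrite [LHS]mx22_eta !mxE. Qed.

Lemma scalar_mx22 a : a%:M = mx22 a 0 0 a.
Proof. by rewrite [LHS]mx22_eta !mxE. Qed.

Lemma tr_mx22 a b c d : \tr (mx22 a b c d) = a + d.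
Proof. by rewrite /mxtrace !big_ord_recl big_ord0 !mxE addr0. Qed.

Lemma det_mx22E a b c d : \det (mx22 a b c d) = a * d - b * c.
Proof.
rewrite (expand_det_row _ ord0) !big_ord_recl big_ord0 /cofactor !det_mx11 !mxE /=.
by ring.
Qed.

Lemma Cayley_Hamilton22 A : A *m A = \tr A *: A - (\det A)%:M.
Proof.
rewrite (mx22_eta A) tr_mx22 det_mx22E -[- _%:M]scaleN1r scalar_mx22 !mx22Z mx22M mx22D.
by apply: eq_mx22; split; ring.
Qed.

(* By Cayley-Hamilton A ^+ k is a linear combination of A and 1; pow_coef k t *)
(* d lists its coefficients in terms of the trace t and the determinant d.    *)
Fixpoint pow_coef k t d : F * F :=
  if k is k'.+1 then
    let: (a, b) := pow_coef k' t d in (a * t + b, - (a * d)) else (0, 1).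

Definition pow_tr k t d : F := (pow_coef k t d).1 * t + (pow_coef k t d).2 *+ 2.

Lemma pow_coefE k A : A ^+ k =
  (pow_coef k (\tr A) (\det A)).1 *: A + (pow_coef k (\tr A) (\det A)).2%:M.
Proof.
elim: k => [|k IHk]; first by rewrite expr0 scale0r add0r.
rewrite exprSr IHk /=; case: (pow_coef _ _ _) => a b /=.
rewrite -mulmxE mulmxDl -scalemxAl mul_scalar_mx Cayley_Hamilton22.
rewrite scalerBr scalerA scale_scalar_mx [RHS]addrC scalerDl addrA.
by rewrite raddfN (addrC (- _)).
Qed.

Lemma pow_trE k A : \tr (A ^+ k) = pow_tr k (\tr A) (\det A).
Proof. by rewrite pow_coefE mxtraceD mxtraceZ mxtrace_scalar. Qed.

Lemma scalar_comb A a b : ~~ is_scalar_mx A -> is_scalar_mx (a *: A + b%:M) = (a == 0).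
Proof.
move=> nscA; apply/is_scalar_mxP/eqP => [[c]|->]; last first.
  by exists b; rewrite scale0r add0r.
move=> /(canRL (addrK _)); rewrite -raddfB /= => aA; apply: contraNeq nscA => a0.
apply/is_scalar_mxP; exists (a^-1 * (c - b)).
by rewrite -scale_scalar_mx -aA scalerK.
Qed.

Definition companion t d := mx22 0 1 (- d) t.

Lemma tr_companion t d : \tr (companion t d) = t.
Proof. by rewrite tr_mx22 add0r. Qed.

Lemma det_companion t d : \det (companion t d) = d.
Proof. by rewrite det_mx22E; ring. Qed.

Lemma companion_not_scalar t d : ~~ is_scalar_mx (companion t d).
Proof.
apply/is_scalar_mxP => -[a /matrixP/(_ 0 1)]; rewrite !mxE /=.
by move/eqP; rewrite oner_eq0.
Qed.

(** A nonscalar 2 x 2 matrix has a cyclic vector: some row (x, y) is independent of its image, and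
    the two rows form P. *)
Lemma companion_similar A : ~~ is_scalar_mx A ->
  exists2 P, P \in unitmx & P *m A = companion (\tr A) (\det A) *m P.
Proof.
rewrite (mx22_eta A) tr_mx22 det_mx22E.
move: (A 0 0) (A 0 1) (A 1 0) (A 1 1) => a b c d nsc.
suffices [x [y xy]] : exists x y, x * (x * b + y * d) - y * (x * a + y * c) != 0.
  exists (mx22 x y (x * a + y * c) (x * b + y * d)).
    by rewrite unitmxE unitfE det_mx22E.
  by rewrite /companion !mx22M; apply: eq_mx22; split; ring.
have [b0|b0] := eqVneq b 0; last first.
  by exists 1, 0; rewrite !mul0r !mul1r !addr0 subr0.
have [c0|c0] := eqVneq c 0; last first.
  by exists 0, 1; rewrite !mul0r !mul1r !add0r oppr_eq0.
exists 1, 1; rewrite b0 c0 !mul1r add0r addr0 subr_eq0.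
apply: contraNneq nsc => da; rewrite b0 c0 da -scalar_mx22.
exact: scalar_mx_is_scalar.
Qed.
End Matrix22.

Lemma F5P (P : 'F_5 -> Prop) : P 0 -> P 1 -> P 2 -> P 3 -> P 4 -> forall x, P x.
Proof.
move=> P0 P1 P2 P3 P4 x; suff: x \in [:: 0; 1; 2; 3; 4 : 'F_5].
  by rewrite !inE => /or4P[/eqP->|/eqP->|/eqP->|/orP[]/eqP->].
by case: x => [[|[|[|[|[|]]]]] //= ?].
Qed.

Lemma sum_F5 (V : nmodType) (f : 'F_5 -> V) : \sum_t f t = f 0 + f 1 + f 2 + f 3 + f 4.
Proof.
rewrite -[\sum_t f t]/(\sum_(t < 5) f t) !big_ord_recl big_ord0 addr0 !addrA.
by do ![congr (_ + _)]; congr (f _); apply: val_inj.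
Qed.

Lemma sum_F5_neq0 (V : nmodType) (f : 'F_5 -> V) :
  \sum_(d | d != 0) f d = f 1 + f 2 + f 3 + f 4.
Proof. by rewrite big_mkcond sum_F5 /= add0r. Qed.

(* A named constant keeps unification from unfolding the group structure. *)
Definition GL25 : finGroupType := {'GL_2(5)}.

Section GL25Classes.
Implicit Types (g h x y z : GL25) (u v : groupRing int GL25) (t d : 'F_5).

Definition GLmx g : 'M['F_5]_2 := GLval (g : {'GL_2(5)}).
Definition tr5 g := \tr (GLmx g).
Definition det5 g := \det (GLmx g).
(** A singular matrix is sent to the identity by default; hence the hypotheses d != 0 on companion
    matrices below. *)
Definition mkGL (A : 'M['F_5]_2) : GL25 := (insubd (1%g : {'GL_2(5)}) A).
Definition companionGL t d := mkGL (companion t d).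
Definition scalarGL g := is_scalar_mx (GLmx g).

Lemma GLmx_inj : injective GLmx. Proof. exact: val_inj. Qed.
Lemma GLmx1 : GLmx 1%g = 1%:M. Proof. by []. Qed.
Lemma GLmxM g h : GLmx (g * h)%g = GLmx g *m GLmx h. Proof. by []. Qed.
Lemma GLmx_unit g : GLmx g \in unitmx. Proof. exact: (valP (g : {'GL_2(5)})). Qed.
Lemma GLmxV g : GLmx g^-1%g = invmx (GLmx g). Proof. by []. Qed.
Lemma GLmxX g k : GLmx (g ^+ k)%g = GLmx g ^+ k.
Proof. by elim: k => // k IHk; rewrite expgS exprS GLmxM IHk. Qed.
Lemma GLmxJ g x : GLmx (g ^ x)%g = invmx (GLmx x) *m GLmx g *m GLmx x.
Proof. by rewrite conjgE !GLmxM GLmxV mulmxA. Qed.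

Lemma mkGLK A : A \in unitmx -> GLmx (mkGL A) = A.
Proof.
move=> Au; rewrite /GLmx /mkGL -[GLval _]/(val _) insubdK //.
Qed.

Lemma det5_neq0 g : det5 g != 0.
Proof. by rewrite -unitfE -unitmxE GLmx_unit. Qed.

Lemma GLmx_comp t d : d != 0 -> GLmx (companionGL t d) = companion t d.
Proof. by move=> d0; rewrite mkGLK // unitmxE unitfE det_companion. Qed.

Lemma tr5J g x : tr5 (g ^ x)%g = tr5 g.
Proof. by rewrite /tr5 GLmxJ mxtrace_mulC mulmxA mulmxV ?GLmx_unit // mul1mx. Qed.

Lemma det5J g x : det5 (g ^ x)%g = det5 g.
Proof.
rewrite /det5 GLmxJ !det_mulmx det_inv mulrAC mulVf ?mul1r //.
exact: det5_neq0.
Qed.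

Lemma det5M g h : det5 (g * h)%g = det5 g * det5 h.
Proof. exact: det_mulmx. Qed.

Lemma sc_central g : scalarGL g -> g \in 'Z([set: GL25])%g.
Proof.
case/is_scalar_mxP => a ga; apply/centerP; split=> [|h _]; first by rewrite inE.
by apply: GLmx_inj; rewrite !GLmxM ga scalar_mxC.
Qed.

Lemma centralJ (gT : finGroupType) (z x : gT) :
  z \in 'Z([set: gT])%g -> (z ^ x)%g = z.
Proof. by move=> /centerP[_ cz]; rewrite conjgE cz ?inE // mulKg. Qed.

Lemma scJ g x : scalarGL (g ^ x)%g = scalarGL g.
Proof.
apply/idP/idP => scg; last by rewrite (centralJ x (sc_central scg)).
by rewrite -(conjgK x g) (centralJ x^-1 (sc_central scg)).
Qed.

Lemma class_comp t d x : d != 0 ->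
  (x \in (companionGL t d ^: [set: GL25])%g) = [&& ~~ scalarGL x, tr5 x == t & det5 x == d].
Proof.
move=> d0; have [tc dc] : tr5 (companionGL t d) = t /\ det5 (companionGL t d) = d.
  by rewrite /tr5 /det5 GLmx_comp // tr_companion det_companion.
have nsc : ~~ scalarGL (companionGL t d) by rewrite /scalarGL GLmx_comp // companion_not_scalar.
apply/idP/and3P => [/imsetP[y _ ->]|[nx /eqP Dt /eqP Dd]].
  by rewrite scJ tr5J det5J tc dc !eqxx.
have [P Pu DP] := companion_similar nx.
have -> : x = (companionGL t d ^ mkGL P)%g.
  apply: GLmx_inj; rewrite GLmxJ GLmx_comp // mkGLK // -mulmxA.
  by rewrite -Dt -Dd -DP mulKmx.
exact/memJ_class/in_setT.
Qed.

Lemma comp_not_sc t d : d != 0 -> ~~ scalarGL (companionGL t d).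
Proof. by move=> d0; rewrite /scalarGL GLmx_comp ?companion_not_scalar. Qed.

Lemma sc_exp g k : ~~ scalarGL g -> scalarGL (g ^+ k)%g = ((pow_coef k (tr5 g) (det5 g)).1 ==
    0).
Proof. by move=> nsc; rewrite /scalarGL GLmxX pow_coefE scalar_comb. Qed.

Lemma tr5X g k : tr5 (g ^+ k)%g = pow_tr k (tr5 g) (det5 g).
Proof. by rewrite /tr5 GLmxX pow_trE. Qed.

Lemma det5X g k : det5 (g ^+ k)%g = det5 g ^+ k.
Proof. by elim: k => [|k IHk]; rewrite ?expgS ?exprS ?det5M ?IHk // /det5 det1. Qed.

Lemma tr5_comp t d : d != 0 -> tr5 (companionGL t d) = t.
Proof. by move=> d0; rewrite /tr5 GLmx_comp // tr_companion. Qed.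

Lemma det5_comp t d : d != 0 -> det5 (companionGL t d) = d.
Proof. by move=> d0; rewrite /det5 GLmx_comp // det_companion. Qed.

Definition class_eps u t d := eps u (companionGL t d).

Lemma sum_GL25 (V : zmodType) (f : GL25 -> V) u :
    (forall x y, f (x ^ y)%g = f x) -> (forall z, scalarGL z -> u z = 0) ->
  \sum_x f x *~ u x = \sum_t \sum_(d | d != 0) f (companionGL t d) *~ class_eps u t d.
Proof.
move=> fJ u0; rewrite (bigID scalarGL) /= big1 ?add0r => [|z /u0->]; last by rewrite mulr0z.
rewrite pair_big_dep /=.
rewrite (partition_big (fun x => (tr5 x, det5 x)) (fun td => td.2 != 0)) /=; last first.
  by move=> x _; rewrite det5_neq0.
apply: eq_bigr => -[t d] /= d0; rewrite /class_eps /eps raddf_sum.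
apply: eq_big => [x|x]; first by rewrite class_comp // xpair_eqE.
move=> /andP[nx /eqP[Dt Dd]].
have /imsetP[y _ ->] : x \in (companionGL t d ^: [set: GL25])%g.
  by rewrite class_comp // nx Dt Dd !eqxx.
by rewrite fJ.
Qed.

Lemma eps_nonscalar u x : ~~ scalarGL x -> eps u x = class_eps u (tr5 x) (det5 x).
Proof.
move=> nx; rewrite /class_eps.
have /imsetP[y _ {1}->] : x \in (companionGL (tr5 x) (det5 x) ^: [set: GL25])%g.
  by rewrite class_comp ?det5_neq0 // nx !eqxx.
by rewrite eps_conj.
Qed.

Lemma eps_sc u z : scalarGL z -> eps u z = u z.
Proof. by move=> /sc_central cz; rewrite /eps (eps_central _ cz). Qed.

Lemma same_eps_comp u t0 d0 : d0 != 0 -> (forall z, scalarGL z -> u z = 0) ->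
    (forall t d, d != 0 -> class_eps u t d = ((t == t0) && (d == d0))%:R) ->
  same_eps u (companionGL t0 d0).
Proof.
move=> d00 u0 Eu x; rewrite eps_gr_of; have [scx|nx] := boolP (scalarGL x).
  rewrite eps_sc // u0 // (_ : (_ \in _) = false) //; apply/negP=> /imsetP[y _ Dy].
  by have := comp_not_sc t0 d00; rewrite Dy scJ scx.
rewrite eps_nonscalar // Eu ?det5_neq0 // class_sym class_comp // nx.
by [].
Qed.

(** This is the norm form of F_5[X]/(X^2 - t X + d), whose unit group has 16, 20 or 24 elements. The
    cruder bound 12 is enough: 480 / 12 = 40 bounds the sums of squares. *)
Lemma norm_form_count t d : d != 0 -> (12 <= size [seq ab <-
  [seq (a, b) | a <- ([:: 0; 1; 2; 3; 4] : seq 'F_5)%R, b <- ([:: 0; 1; 2; 3; 4] : seq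
      'F_5)%R] |
    (ab.1 ^+ 2 * d + ab.1 * ab.2 * t + ab.2 ^+ 2 != 0)%R])%N.
Proof. by elim/F5P: d; elim/F5P: t. Qed.

(** The centralizer contains the units a A + b of the algebra generated by the companion matrix
    A. *)
Lemma cent1_comp_ge t d : d != 0 -> (12 <= #|'C[companionGL t d]%g|)%N.
Proof.
move=> d0; pose f (ab : 'F_5 * 'F_5) := mkGL (ab.1 *: companion t d + ab.2%:M).
pose q (ab : 'F_5 * 'F_5) := \det (ab.1 *: companion t d + ab.2%:M) != 0.
pose r5 := [:: 0; 1; 2; 3; 4 : 'F_5].
pose s := [seq ab <- [seq (a, b) | a <- r5, b <- r5] | q ab].
have qE ab : q ab = (ab.1 ^+ 2 * d + ab.1 * ab.2 * t + ab.2 ^+ 2 != 0).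
  rewrite /q /companion scalar_mx22 mx22Z mx22D det_mx22E; congr (_ != 0); ring.
have sz_s : (12 <= size s)%N.
  by rewrite /s (eq_filter qE); exact: norm_form_count.
apply: leq_trans sz_s _.
have fK ab : ab \in s -> GLmx (f ab) = ab.1 *: companion t d + ab.2%:M.
  by rewrite mem_filter => /andP[qab _]; rewrite mkGLK // unitmxE unitfE.
have f_inj : {in s &, injective f}.
  move=> [a b] [a' b'] /fK /= fab /fK /= fab' ff.
  move: fab; rewrite ff fab' => /matrixP E'.
  have := E' 0 1; rewrite !mxE /= !mulr1 !mulr0n !addr0 => ->.
  by have := E' 0 0; rewrite !mxE /= !mulr0 !mulr1n !add0r => ->.
have us : uniq (map f s) by rewrite map_inj_in_uniq // filter_uniq.
rewrite -(size_map f) -(card_uniqP us); apply/subset_leq_card/subsetP => x.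
move=> /mapP[ab /fK fab ->]; apply/cent1P/GLmx_inj.
move: (f ab) fab => y Dy.
rewrite (GLmxM (companionGL t d) y) (GLmxM y (companionGL t d)) Dy (GLmx_comp t d0).
rewrite mulmxDl mulmxDr.
congr (_ + _).
  by rewrite -scalemxAl -scalemxAr.
by rewrite scalar_mxC.
Qed.
End GL25Classes.

(* Trace and determinant parametrize the classes of noncentral elements. *)
Definition class_params : seq ('F_5 * 'F_5) :=
  [seq (t, d) | t <- ([:: 0; 1; 2; 3; 4] : seq 'F_5), d <- ([:: 1; 2; 3; 4] : seq 'F_5)].

Lemma mem_class_params td : (td \in class_params) = (td.2 != 0).
Proof. by case: td => t d; elim/F5P: d; elim/F5P: t. Qed.

Lemma sum_class_params (V : nmodType) (f : 'F_5 * 'F_5 -> V) :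
  \sum_t \sum_(d | d != 0) f (t, d) = \sum_(td <- class_params) f td.
Proof.
rewrite sum_F5 !sum_F5_neq0 big_allpairs_dep /= !big_cons !big_nil !addr0.
by rewrite !addrA.
Qed.

(* The classes of noncentral elements whose k-th power is z%:M. *)
Definition power_params k (z : 'F_5) : seq ('F_5 * 'F_5) :=
  [seq td <- class_params | pow_coef k td.1 td.2 == (0, z)].

(** * Units of augmentation 1 *)

Section AugmentationOne.
Variable gT : finGroupType.
Implicit Types (u v : groupRing int gT) (g h : gT).

Definition augment u := \sum_x u x.

Lemma augment_ext u : augment u = gr_ext (fun=> 1 : int) u.
Proof. by apply: eq_bigr => x _; rewrite intz. Qed.

Lemma augmentX u k : augment (u ^+ k) = augment u ^+ k.
Proof. by rewrite !augment_ext gr_extX // => x y; rewrite mulr1. Qed.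

Lemma augment_of g : augment (gr_of int g) = 1.
Proof. by rewrite augment_ext gr_ext_of. Qed.

Lemma augmentN u : augment (- u) = - augment u.
Proof. by rewrite /augment -sumrN; apply: eq_bigr => x _; rewrite grNE. Qed.

Lemma central_coef1 u n z : (0 < n)%N -> u ^+ n = 1 -> augment u = 1 ->
  z \in 'Z([set: gT])%g -> u z != 0 -> u = gr_of int z.
Proof.
move=> n_gt0 un u1 cz uz; have [|//|uN] := central_coef n_gt0 un cz; first by [].
by move: u1; rewrite uN augmentN augment_of.
Qed.

(** Peel one prime factor off [m] at a time and apply [same_eps_expp]. *)
Lemma same_eps_exp u g : (forall m, exists h, same_eps (u ^+ m) h) ->
  same_eps u g -> forall m, same_eps (u ^+ m) (g ^+ m)%g.
Proof.
move=> pw ug m; elim/ltn_ind: m => m IHm.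
have [->|m_gt0] := posnP m; first by rewrite expr0 expg0.
have [->|m1] := eqVneq m 1%N; first by rewrite expr1 expg1.
have m_gt1 : (1 < m)%N by rewrite ltn_neqAle eq_sym m1.
have := pdiv_dvd m; have := pdiv_prime m_gt1; move: (pdiv m) => p p_pr /dvdnP[j Dm].
have [h uh] := pw m; move: uh; rewrite Dm exprM => uh; rewrite expgM.
apply: same_eps_expp uh => //; apply: IHm.
by have := prime_gt1 p_pr; rewrite Dm; nia.
Qed.
End AugmentationOne.

(** * Orders modulo scalar matrices *)

Section ScalarMatrices.
Implicit Types (g h x y z : GL25).

Lemma sc1 : scalarGL 1%g.
Proof. by rewrite /scalarGL GLmx1 scalar_mx_is_scalar. Qed.

Lemma scM g h : scalarGL g -> scalarGL h -> scalarGL (g * h)%g.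
Proof.
rewrite /scalarGL GLmxM => /is_scalar_mxP[a ->] /is_scalar_mxP[b ->].
by rewrite -scalar_mxM scalar_mx_is_scalar.
Qed.

Lemma scX g k : scalarGL g -> scalarGL (g ^+ k)%g.
Proof. by move=> gs; elim: k => [|k IHk]; rewrite ?sc1 // expgS scM. Qed.

Lemma scV g : scalarGL g -> scalarGL g^-1%g.
Proof. by move=> gs; rewrite invg_expg scX. Qed.

Lemma sc_coprime g j k : coprime j k -> (0 < j)%N ->
  scalarGL (g ^+ j)%g -> scalarGL (g ^+ k)%g -> scalarGL g.
Proof.
move=> jk j_gt0 gj gk; have [a b Dab _] := egcdnP k j_gt0.
have : scalarGL (g ^+ (a * j) * g ^- (b * k))%g.
  by rewrite scM ?scV // mulnC expgM scX.
by rewrite Dab (eqP jk) addnC expgD expg1 mulgK.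
Qed.

(** PGL(2, 5) is isomorphic to S_5, whose elements have order at most 6; here all traces and
    determinants are checked. *)
Lemma sc_exp_le6 g : ~~ scalarGL g -> exists2 j, (1 < j <= 6)%N & scalarGL (g ^+ j)%g.
Proof.
move=> ng; suffices /hasP[j] : has (fun j => (pow_coef j (tr5 g) (det5 g)).1 == 0)
    [:: 2; 3; 4; 5; 6].
  by rewrite -sc_exp // !inE => j26 gj; exists j; last exact: gj; lia.
have := det5_neq0 g; move: (tr5 g) (det5 g) => t d.
by elim/F5P: d; elim/F5P: t => // _; vm_compute.
Qed.

(** The hypotheses say that the p-th power of the companion matrix is nonscalar with the trace and
    determinant of [h], hence conjugate to [h]. *)
Lemma comp_exp_conj h p (t d : 'F_5) : ~~ scalarGL h -> d != 0 -> ~~ scalarGL (companionGL t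
    d ^+ p)%g ->
  pow_tr p t d = tr5 h -> d ^+ p = det5 h -> forall j, scalarGL (h ^+ j)%g = scalarGL
      (companionGL t d ^+ (p * j))%g.
Proof.
move=> nh d0 nc trh deth j; rewrite expgM.
have : h \in (companionGL (tr5 h) (det5 h) ^: [set: GL25])%g.
  by rewrite class_comp ?det5_neq0 // nh !eqxx.
have : (companionGL t d ^+ p)%g \in (companionGL (tr5 h) (det5 h) ^: [set: GL25])%g.
  by rewrite class_comp ?det5_neq0 // nc tr5X det5X tr5_comp // det5_comp // trh deth !eqxx.
move: (companionGL t d ^+ p)%g (companionGL (tr5 h) (det5 h)) => c y /imsetP[x1 _ ->]
    /imsetP[x2 _ ->].
by rewrite -(conjXg y x1) -(conjXg y x2) (scJ _ x1) (scJ _ x2).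
Qed.
End ScalarMatrices.

Lemma gr_mulzE (gT : finGroupType) (v : groupRing int gT) m (g : gT) : (v *~ m) g = v g *~ m.
Proof.
have nE k w : (w *+ k : groupRing int gT) g = w g *+ k.
  by elim: k => [|k IHk]; rewrite ?gr0E // !mulrS grDE IHk.
by case: m => k; rewrite ?NegzE ?mulrNz ?grNE -!pmulrn nE.
Qed.

Definition detU (x : GL25) : {unit 'F_5} := insubd (1%g : {unit 'F_5}) (det5 x).

Lemma detUE x : val (detU x) = det5 x.
Proof. by rewrite insubdK // unitfE det5_neq0. Qed.

Lemma detUM x y : detU (x * y)%g = (detU x * detU y)%g.
Proof. by apply: val_inj; rewrite /= !detUE det5M. Qed.

Lemma detU1 : detU 1%g = 1%g.
Proof. by apply: val_inj; rewrite detUE /det5 det1. Qed.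

Lemma card_GL25 : #|GL25| = 480%N.
Proof. by have := card_GL_2 ('F_5); rewrite card_Fp // cardsT => ->. Qed.

Lemma sum_subseq_le (T : finType) (F : T -> int) (s r : seq T) :
    uniq s -> uniq r -> {subset s <= r} -> (forall x, 0 <= F x) ->
  \sum_(x <- s) F x <= \sum_(x <- r) F x.
Proof.
move=> us ur sr F0; rewrite !big_uniq // [leRHS](bigID (mem s)) /= -[leLHS]addr0.
apply: lerD; last by apply: sumr_ge0.
rewrite le_eqVlt; apply/orP; left; apply/eqP/eq_bigl => x.
by case: (boolP (x \in s)) => [/sr->|_]; rewrite ?andbF.
Qed.

Lemma card_cent1J (gT : finGroupType) (g x : gT) : #|'C[g ^ x]%g| = #|'C[g]%g|.
Proof. by rewrite cent1J cardJg. Qed.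

Lemma cent1_mul_central (gT : finGroupType) (z g : gT) : z \in 'Z([set: gT])%g ->
  'C[z * g]%g = 'C[g]%g.
Proof.
move=> cz; apply/setP => x; rewrite !cent1_conj conjMg.
have /centerP[_ czx] := cz; have -> : (z ^ x)%g = z.
  by rewrite conjgE czx ?inE // mulKg.
by rewrite (inj_eq (mulgI z)).
Qed.

Definition minus_one : GL25 := mkGL (- 1)%:M.

Lemma GLmx_minus_one : GLmx minus_one = (- 1)%:M.
Proof. by rewrite mkGLK // unitmxE det_scalar. Qed.

Lemma sc_minus_one : scalarGL minus_one.
Proof. by rewrite /scalarGL GLmx_minus_one scalar_mx_is_scalar. Qed.

Lemma sc_minus_oneM g : scalarGL (minus_one * g)%g = scalarGL g.
Proof.
apply/idP/idP => [mg|]; last exact: scM sc_minus_one.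
by rewrite -(mulKg minus_one g) scM ?scV ?sc_minus_one.
Qed.

Lemma tr5_minus_oneM g : tr5 (minus_one * g)%g = - tr5 g.
Proof. by rewrite /tr5 GLmxM GLmx_minus_one mul_scalar_mx mxtraceZ mulN1r. Qed.

Lemma det5_minus_oneM g : det5 (minus_one * g)%g = det5 g.
Proof. by rewrite det5M {1}/det5 GLmx_minus_one det_scalar sqrrN expr1n mul1r. Qed.

Lemma minus_one2 : (minus_one ^+ 2 = 1)%g.
Proof. by apply: GLmx_inj; rewrite GLmxX GLmx_minus_one -rmorphXn sqrrN expr1n. Qed.

Lemma minus_one_neq1 : minus_one != 1%g.
Proof.
apply/eqP => /(congr1 GLmx); rewrite GLmx_minus_one GLmx1 => /matrixP/(_ 0 0).
by rewrite !mxE.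
Qed.

(** * Linear and quadratic constraints on partial augmentations *)

Section UnitSums.
Variables (u : groupRing int GL25) (n : nat).
Hypotheses (n_gt0 : (0 < n)%N) (un : u ^+ n = 1) (u1 : augment u = 1).
Hypothesis u_sc : forall z, scalarGL z -> u z = 0.
Implicit Types (g h x y z : GL25) (t d : 'F_5) (s : seq ('F_5 * 'F_5)).

Definition param_eps (td : 'F_5 * 'F_5) := class_eps u td.1 td.2.

Lemma sum_param_eps (V : zmodType) (f : GL25 -> V) :
    (forall x y, f (x ^ y)%g = f x) ->
  \sum_x f x *~ u x = \sum_(td <- class_params) f (companionGL td.1 td.2) *~ param_eps td.
Proof. by move=> fJ; rewrite sum_GL25 // -sum_class_params. Qed.

(* The determinant maps u to a torsion unit of the group ring of an abelian   *)
(* group, which is trivial by Berman-Higman.                                  *)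
Lemma det_sums : exists d0, forall d, d != 0 ->
  \sum_(td <- class_params | td.2 == d) param_eps td = (d == d0)%:R.
Proof.
pose v := gr_ext (fun x => gr_of int (detU x)) u.
have vE w : v w = \sum_x (detU x == w)%:R *~ u x.
  by rewrite /v gr_sumE; apply: eq_bigr => x _; rewrite gr_mulzE gr_ofE eq_sym.
have vn : v ^+ n = 1.
  rewrite -gr_extX ?un; first by rewrite -gr_of1 gr_ext_of detU1.
    by rewrite detU1.
  by move=> x y; rewrite detUM gr_ofM.
have v1 : augment v = 1.
  rewrite -u1 /augment; under eq_bigr do rewrite vE.
  rewrite exchange_big; apply: eq_bigr => x _ /=.
  rewrite (bigD1 (detU x)) //= eqxx intz big1 ?addr0 // => w /negPf wx.
  by rewrite eq_sym wx mul0rz.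
have [w0 vw0] : exists w, v w != 0.
  apply/existsP; apply: contraT; rewrite negb_exists => /forallP v0.
  by move: v1; rewrite /augment big1 // => w _; apply/eqP; move: (v0 w); rewrite negbK.
have cw0 : w0 \in 'Z([set: {unit 'F_5}])%g.
  apply/centerP; split=> [|w _]; first by rewrite inE.
  by apply: val_inj; rewrite /= mulrC.
have Dv := central_coef1 n_gt0 vn v1 cw0 vw0.
exists (val w0) => d d0; have Ud : d \is a GRing.unit by rewrite unitfE.
have : v (FinRing.unit 'F_5 Ud) = (d == val w0)%:R by rewrite Dv gr_ofE -val_eqE.
move=> <-; rewrite vE sum_param_eps => [|x y]; last first.
  by congr (nat_of_bool _)%:R; rewrite -!val_eqE /= !detUE det5J.
rewrite big_mkcond !big_seq; apply: eq_bigr => -[t d'].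
rewrite mem_class_params /= => d'0.
have -> : (detU (companionGL t d') == FinRing.unit 'F_5 Ud) = (d' == d).
  by rewrite -(inj_eq val_inj) detUE det5_comp.
by case: ifP => _; rewrite ?mul0rz ?mulr1z ?intz.
Qed.

Definition cent_card (td : 'F_5 * 'F_5) := #|'C[companionGL td.1 td.2]%g|.

(** From the trace bound 480 and centralizers of order at least 12. *)
Lemma sum_param_eps_sqr s : uniq s -> {subset s <= class_params} ->
  \sum_(td <- s) param_eps td ^+ 2 <= 40.
Proof.
move=> us sub; apply: (@le_trans _ _ (\sum_(td <- class_params) param_eps td ^+ 2)).
  by apply: sum_subseq_le => // td; exact: sqr_ge0.
have := eps_norm_bound n_gt0 un; rewrite card_GL25.
under eq_bigr => g _ do rewrite mulrC -mulrzz.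
rewrite sum_param_eps => [Le|x y]; last by rewrite eps_conj card_cent1J.
suff: 12 * \sum_(td <- class_params) param_eps td ^+ 2 <= 480 by lia.
apply: le_trans Le; rewrite mulr_sumr !big_seq; apply: ler_sum => td.
rewrite mem_class_params => /(cent1_comp_ge td.1) c12.
rewrite -[leRHS]/((param_eps td *+ cent_card td) *~ param_eps td) mulrzz [leRHS]mulrnAl.
by rewrite -expr2 mulr_natl ler_wpMn2l ?sqr_ge0.
Qed.

Lemma eps_minus_one t d : d != 0 -> eps u (minus_one * companionGL t d)%g = param_eps (- t, d).
Proof.
move=> d0; have nsc : ~~ scalarGL (minus_one * companionGL t d)%g.
  by rewrite sc_minus_oneM; exact: comp_not_sc.
rewrite (eps_nonscalar u nsc) (tr5_minus_oneM (companionGL t d)) (det5_minus_oneM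
    (companionGL t d)).
by rewrite (tr5_comp t d0) (det5_comp t d0).
Qed.

Lemma cent_cardN t d : d != 0 -> cent_card (- t, d) = cent_card (t, d).
Proof.
move=> d0; rewrite /cent_card /=.
transitivity #|'C[(minus_one * companionGL t d)%g]%g|; last first.
  by rewrite (cent1_mul_central (companionGL t d) (sc_central sc_minus_one)).
have /imsetP[x _ ->] : (minus_one * companionGL t d)%g \in (companionGL (- t) d ^: [set:
    GL25])%g.
  rewrite (class_comp (- t) _ d0) (sc_minus_oneM (companionGL t d)) (negPf (comp_not_sc t d0)).
  rewrite (tr5_minus_oneM (companionGL t d)) (det5_minus_oneM (companionGL t d)).
  by rewrite (tr5_comp t d0) (det5_comp t d0) !eqxx.
by rewrite card_cent1J.
Qed.

Lemma sum_param_eps_odd_sqr s : uniq s -> {subset s <= class_params} ->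
  \sum_(td <- s) (param_eps td - param_eps (- td.1, td.2)) ^+ 2 <= 80.
Proof.
move=> us sub; pose D td := param_eps td - param_eps (- td.1, td.2).
apply: (@le_trans _ _ (\sum_(td <- class_params) D td ^+ 2)).
  by apply: sum_subseq_le => // td; exact: sqr_ge0.
have cz := sc_central sc_minus_one.
have := eps_odd_norm_bound n_gt0 un cz minus_one2 minus_one_neq1.
rewrite card_GL25; pose f g := eps u g *+ #|'C[g]%g|.
have fJ x y : f (x ^ y)%g = f x by rewrite /f eps_conj card_cent1J.
have -> : \sum_g (u g - u (minus_one * g)%g) * (eps u g *+ #|'C[g]%g|) =
    \sum_g (f g - f (minus_one * g)%g) *~ u g.
  under eq_bigr do rewrite mulrBl.
  rewrite big_split sumrN /= [X in _ - X](reindex_inj (mulgI minus_one)) /=.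
  rewrite -sumrB; apply: eq_bigr => g _.
  by rewrite mulrzz mulgA -expg2 minus_one2 mul1g mulrBl ![_ * u g]mulrC.
rewrite sum_param_eps => [Le|x y]; last first.
  by rewrite fJ -{1}(centralJ y cz) -conjMg fJ.
have {}Le : \sum_t \sum_(d | d != 0) D (t, d) * param_eps (t, d) *+ cent_card (t, d) <= 480.
  apply: le_trans Le; rewrite -sum_class_params; apply: ler_sum => t _.
  apply: ler_sum => d d0; rewrite /f cent1_mul_central // eps_minus_one //.
  by rewrite mulrzz -mulrnBl mulrnAl.
(* [D] is odd in t, so adding the terms of (t, d) and (-t, d) turns D times [param_eps] into the
   square of D; this doubles 480 to 960, and 960 / 12 = 80. *)
have Le2 : \sum_t \sum_(d | d != 0) D (t, d) ^+ 2 *+ cent_card (t, d) <= 960.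
  suff -> : \sum_t \sum_(d | d != 0) D (t, d) ^+ 2 *+ cent_card (t, d) =
    (\sum_t \sum_(d | d != 0) D (t, d) * param_eps (t, d) *+ cent_card (t, d)) *+ 2 by lia.
  rewrite mulr2n [X in _ = _ + X](reindex_inj oppr_inj) -big_split; apply: eq_bigr => t _ /=.
  rewrite -big_split; apply: eq_bigr => d d0 /=; rewrite cent_cardN // -mulrnDl.
  suff -> : D (t, d) ^+ 2 = D (t, d) * param_eps (t, d) + D (- t, d) * param_eps (- t, d) by [].
  by rewrite /D /= opprK; move: (param_eps _) (param_eps _) => a b; ring.
suff: 12 * \sum_(td <- class_params) D td ^+ 2 <= 960 by lia.
move: Le2; rewrite (sum_class_params (fun td => D td ^+ 2 *+ cent_card td)).
apply: le_trans; rewrite mulr_sumr !big_seq.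
apply: ler_sum => td; rewrite mem_class_params => /(cent1_comp_ge td.1) c12.
by rewrite mulr_natl ler_wpMn2l ?sqr_ge0.
Qed.
End UnitSums.

(** * The symmetric square and traces of powers *)

Section Sym2.
Variable F : fieldType.
Implicit Types A B : 'M[F]_2.

(* The symmetric square in the basis x^2, xy, y^2. *)
Definition sym2 A : 'M[F]_3 := \matrix_(i, j)
  let: (a, b, c, d) := (A 0 0, A 0 1, A 1 0, A 1 1) in
  nth 0 (nth [::] [:: [:: a * a; a * b *+ 2; b * b]; [:: a * c; a * d + b * c; b * d];
                      [:: c * c; c * d *+ 2; d * d]] i) j.

Lemma sym2M A B : sym2 (A *m B) = sym2 A *m sym2 B.
Proof.
rewrite (mx22_eta A) (mx22_eta B) mx22M.
move: (A 0 0) (A 0 1) (A 1 0) (A 1 1) (B 0 0) (B 0 1) (B 1 0) (B 1 1).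
move=> a b c d a' b' c' d'; apply/matrixP => i j; rewrite !mxE !big_ord_recl big_ord0 !mxE /=.
by case: i j => [[|[|[|]]] // ?] [[|[|[|]]] // ?] /=; ring.
Qed.

Lemma sym2_scalar a : sym2 a%:M = (a ^+ 2)%:M.
Proof.
apply/matrixP => i j; rewrite !mxE /=.
by case: i j => [[|[|[|]]] // ?] [[|[|[|]]] // ?] /=;
  rewrite -?val_eqE /= ?mulr1n ?mulr0n; ring.
Qed.

Lemma tr_sym2 A : \tr (sym2 A) = \tr A ^+ 2 - \det A.
Proof.
rewrite {2 3}(mx22_eta A) tr_mx22 det_mx22E /mxtrace !big_ord_recl big_ord0 !mxE /=.
by ring.
Qed.

(** The trace of C^m times the Cayley-Hamilton relation; only the coefficient \tr C is made
    explicit. *)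
Lemma mxtrace_recurrence3 (C : 'M[F]_3) : exists b c, forall m,
  \tr (C ^+ m.+3) = \tr C * \tr (C ^+ m.+2) + b * \tr (C ^+ m.+1) + c * \tr (C ^+ m).
Proof.
have := Cayley_Hamilton C; have := @char_poly_trace _ _ C isT.
have := char_poly_monic C; rewrite monicE lead_coefE size_char_poly /= => /eqP p3 p2.
rewrite -[char_poly C]coefK poly_def size_char_poly !big_ord_recr big_ord0 /= add0r.
rewrite p3 p2 expr0 expr1 !rmorphD /= !horner_mxZ !rmorphXn /= horner_mx_X rmorph1.
move=> CH; exists (- (char_poly C)`_1), (- (char_poly C)`_0) => m.
have := congr1 (fun M => \tr (C ^+ m * M)) CH.
rewrite /= mulr0 mxtrace0 !mulrDr -!scalerAr mulr1 -!exprD -exprSr !mxtraceD !mxtraceZ.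
rewrite addn2 addn3 => e0; rewrite -[LHS]subr0 -[in LHS]e0; ring.
Qed.
End Sym2.

Lemma mxtrace_inv22 (F : fieldType) (A : 'M[F]_2) : A \in unitmx ->
  \tr (invmx A) = \tr A / \det A.
Proof.
move=> Au; have dA : \det A != 0 by rewrite -unitfE -unitmxE.
have -> : invmx A = (\det A)^-1 *: ((\tr A)%:M - A).
  apply: (can_inj (mulKmx Au)); rewrite mulmxV // -scalemxAr mulmxBr mul_mx_scalar.
  by rewrite Cayley_Hamilton22 opprB addrCA subrr addr0 scale_scalar_mx mulVf.
by rewrite mxtraceZ mxtraceD raddfN /= mxtrace_scalar mulrC mulr2n addrK.
Qed.

Lemma eqz_Fp p (x y : int) : prime p -> (x%:~R == y%:~R :> 'F_p) = (p%:Z %| x - y)%Z.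
Proof. by move=> p_pr; rewrite (dvdz_pcharf (pchar_Fp p_pr)) rmorphB subr_eq0. Qed.

Lemma mxtrace_ext m (rho : GL25 -> 'M['F_5]_m) u :
  \tr (gr_ext rho u) = \sum_x \tr (rho x) *~ u x.
Proof. by rewrite /gr_ext raddf_sum; apply: eq_bigr => x _; rewrite raddfMz. Qed.

Lemma same_eps_mxtrace m (rho : GL25 -> 'M['F_5]_m) u h :
    (forall x y, \tr (rho (x ^ y)%g) = \tr (rho x)) -> same_eps u h ->
  \tr (gr_ext rho u) = \tr (rho h).
Proof. by move=> rJ uh; rewrite mxtrace_ext (same_eps_sum rJ uh). Qed.

Definition GLsym2 (g : GL25) := sym2 (GLmx g).

Lemma GLsym2M x y : GLsym2 (x * y)%g = GLsym2 x * GLsym2 y.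
Proof. by rewrite /GLsym2 GLmxM sym2M. Qed.

Lemma GLsym2_1 : GLsym2 1%g = 1.
Proof. by rewrite /GLsym2 GLmx1 sym2_scalar expr1n. Qed.

Lemma tr_GLsym2 g : \tr (GLsym2 g) = tr5 g ^+ 2 - det5 g.
Proof. exact: tr_sym2. Qed.

Lemma tr_GLsym2J x y : \tr (GLsym2 (x ^ y)%g) = \tr (GLsym2 x).
Proof. by rewrite !tr_GLsym2 tr5J det5J. Qed.

Lemma memV_class (gT : finGroupType) (x y : gT) :
  (x^-1 \in (y^-1 ^: [set: gT]))%g = (x \in (y ^: [set: gT]))%g.
Proof.
apply/imsetP/imsetP => -[w _ Dw]; exists w => //; apply: invg_inj;
  by rewrite Dw ?invgK -conjVg ?invgK.
Qed.

(* An inverse of u has coefficient sum eps u g^-1 on the class of g. *)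
Lemma sum_inverse (V : zmodType) (gT : finGroupType) (f : gT -> V)
    (u : groupRing int gT) n :
    (forall x y, f (x ^ y)%g = f x) -> u ^+ n.+1 = 1 ->
  \sum_x f x *~ (u ^+ n) x = \sum_x f x^-1%g *~ u x.
Proof.
move=> fJ un; rewrite (reindex_inj invg_inj) /=.
pose v := gr_fun (fun x => (u ^+ n) x^-1%g).
transitivity (\sum_x f x^-1%g *~ v x).
  by apply: eq_bigr => x _; rewrite gr_funE.
apply: (@eq_eps_sum _ _ (fun x => f x^-1%g) v u) => [x y|g]; first by rewrite -conjVg fJ.
rewrite -(eps_inv g un) /eps [RHS](reindex_inj invg_inj) /=.
by apply: eq_big => [x|x _]; rewrite ?gr_funE // memV_class.
Qed.

(** * Supports for each exponent, and the resulting integer equations *)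

Lemma sum_cons (V : nmodType) (T : Type) (F : T -> V) x (s : seq T) :
  \sum_(y <- x :: s) F y = F x + \sum_(y <- s) F y.
Proof. exact: big_cons. Qed.

(** Whether the p-th power is nonscalar, with its trace and determinant: in the nonscalar case, its
    conjugacy class. *)
Definition pow_class p (td : 'F_5 * 'F_5) :=
  (((pow_coef p td.1 td.2).1 != 0, pow_tr p td.1 td.2), td.2 ^+ p).

(* The classes of PGL-order not dividing m. *)
Definition nonscalar_pow m (s : seq ('F_5 * 'F_5)) :=
  [seq td <- s | (pow_coef m td.1 td.2).1 != 0].

(** A noncentral g with g^k = b has trace 0 and determinant -b for k = 2; it is an element of order
    3 times the cube root of b for k = 3, and b times a unipotent for k = 5. *)
Lemma size_supp235 (b : 'F_5) : all (fun m => size (power_params m b) <= 1)%N [:: 2; 3; 5]%N.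
Proof. by elim/F5P: b; vm_compute. Qed.

(* For k = 15 the support consists of one class of PGL-order 3 and one of    *)
(* PGL-order 5.                                                               *)
Lemma supp15 (b : 'F_5) : b != 0 -> exists x y : 'F_5 * 'F_5, [/\ perm_eq (power_params 15 b)
    [:: x; y],
  nonscalar_pow 3 (power_params 15 b) = [:: x] /\
    [seq td <- power_params 15 b | pow_class 3 td == pow_class 3 x] = [:: x] &
  nonscalar_pow 5 (power_params 15 b) = [:: y] /\
    [seq td <- power_params 15 b | pow_class 5 td == pow_class 5 y] = [:: y]].
Proof.
elim/F5P: b => // _; [exists (2, 1), (4, 1)|exists (1, 4), (2, 4)|exists (4, 4), (3, 4)
  |exists (3, 1), (1, 1)]; split; try split; try apply/eqP; by vm_compute.
Qed.

(* For k = 2q with q = 3 or 5 the support contains one class of involutions   *)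
(* of PGL(2, 5), told apart from the others by its determinant.               *)
Lemma supp_2q m q (b : 'F_5) :
    (m, q, b) \in [:: (6%N, 3%N, 1); (6%N, 3%N, 4); (10%N, 5%N, 1); (10%N, 5%N, 4)] ->
  exists e x y : 'F_5 * 'F_5, [/\ power_params m b = [:: e; x; y],
    nonscalar_pow 2 (power_params m b) = [:: x; y] /\
      {in [:: x; y], forall c, [seq td <- power_params m b | pow_class 2 td == pow_class 2 c]
          = [:: x; y]},
    nonscalar_pow q (power_params m b) = [:: e] /\
      [seq td <- power_params m b | pow_class q td == pow_class q e] = [:: e] &
    e.2 != 0 /\ [seq td <- power_params m b | td.2 == e.2] = [:: e]].
Proof.
rewrite !inE => /or4P[] /eqP[-> -> ->];
  [exists (0, 4), (1, 1), (4, 1)|exists (0, 1), (2, 4), (3, 4)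
  |exists (0, 4), (2, 1), (3, 1)|exists (0, 1), (1, 4), (4, 4)];
  split; try split; try apply/eqP; try (by vm_compute);
  by move=> c; rewrite !inE => /orP[] /eqP->; apply/eqP; vm_compute.
Qed.

(** An element of PGL-order 5 is a scalar s times a unipotent, with tenth power s^2, whereas 2 and 3
    are nonsquares; and no element has PGL-order 10. *)
Lemma supp_10 (b : 'F_5) : b \in [:: 2; 3] -> nonscalar_pow 2 (power_params 10 b) = [::].
Proof. by rewrite !inE => /orP[] /eqP->; apply/eqP; vm_compute. Qed.

Lemma F5_neq0 (b : 'F_5) : b != 0 -> b \in [:: 1; 2; 3; 4].
Proof. by elim/F5P: b. Qed.

(** PGL(2, 5) has no elements of order 8, 9 or 25. *)
Lemma supp_empty (b : 'F_5) : [/\ nonscalar_pow 4 (power_params 8 b) = [::],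
  nonscalar_pow 3 (power_params 9 b) = [::] & nonscalar_pow 5 (power_params 25 b) = [::]].
Proof. by split; apply/eqP; elim/F5P: b; vm_compute. Qed.

Lemma supp_12 (b : 'F_5) : all (fun td =>
  ((pow_coef 4 td.1 td.2).1 == 0) || ((pow_coef 6 td.1 td.2).1 == 0)) (power_params 12 b).
Proof. by elim/F5P: b; vm_compute. Qed.

(** Used for the image of [u] in 2 x 2 matrices modulo 5, of trace [t] and determinant [d], when k =
    6. *)
Lemma std6_trace (b t d : 'F_5) : b \in [:: 2; 3] -> pow_tr 2 t d = b ->
  pow_tr 3 t d = 0 -> pow_tr 6 t d = b *+ 2 -> t \in (if b == 2 then [:: 1; 4] else [:: 2; 3]).
Proof.
move=> b23 /eqP D2 /eqP D3 /eqP D6; apply: contraTT b23 => nt; move: D2 D3 D6 nt.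
by elim/F5P: b; elim/F5P: t; elim/F5P: d; vm_compute.
Qed.

(* The arguments are the coefficients of the characteristic polynomial of a   *)
(* 3 x 3 matrix C with C ^+ 6 = (b ^+ 2)%:M and the given traces of powers.   *)
Lemma sqr6_trace (b al be ga p3 p4 p5 : 'F_5) : b \in [:: 2; 3] ->
    p3 = - b ^+ 3 -> p3 = al * 0 + be * al + ga * 3 ->
    p4 = al * p3 + be * 0 + ga * al -> p5 = al * p4 + be * p3 + ga * 0 ->
    b ^+ 2 *+ 3 = al * p5 + be * p4 + ga * p3 ->
    b ^+ 2 * al = al * (b ^+ 2 *+ 3) + be * p5 + ga * p4 ->
    b ^+ 2 * 0 = al * (b ^+ 2 * al) + be * (b ^+ 2 *+ 3) + ga * p5 ->
  al = if b == 2 then 4 else 1.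
Proof.
move=> b23 -> /eqP E3 -> -> /eqP E6 /eqP E7 /eqP E8; apply/eqP; apply: contraTT b23 => nal.
move: E3 E6 E7 E8 nal.
by elim/F5P: b; elim/F5P: al; elim/F5P: be; elim/F5P: ga; vm_compute.
Qed.

(* For k = 6 and b a nonsquare: an involution and two elements of order 6 of  *)
(* PGL(2, 5).                                                                 *)
Definition classes6 (b : 'F_5) : seq ('F_5 * 'F_5) :=
  if b == 2 then [:: (0, 2); (1, 2); (4, 2)] else [:: (0, 3); (2, 3); (3, 3)].

Lemma supp_6 (b : 'F_5) : b \in [:: 2; 3] -> [/\ power_params 6 b = classes6 b,
  nonscalar_pow 2 (power_params 6 b) = behead (classes6 b),
  {in behead (classes6 b), forall c, pow_tr 2 c.1 c.2 = b /\ c.2 ^+ 2 = b ^+ 2 /\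
    [seq td <- power_params 6 b | pow_class 2 td == pow_class 2 c] = behead (classes6 b)} &
  {in classes6 b, forall c, pow_tr 3 c.1 c.2 = 0 /\ c.2 ^+ 3 = b ^+ 3}].
Proof.
rewrite !inE => /orP[] /eqP->; split; try by apply/eqP; vm_compute.
- by move=> c; rewrite !inE => /orP[] /eqP->; do ?split; apply/eqP; vm_compute.
- by move=> c; rewrite !inE => /or3P[] /eqP->; do ?split; apply/eqP; vm_compute.
- by move=> c; rewrite !inE => /orP[] /eqP->; do ?split; apply/eqP; vm_compute.
by move=> c; rewrite !inE => /or3P[] /eqP->; do ?split; apply/eqP; vm_compute.
Qed.

(** Traces of the natural representation and of its symmetric square at the three classes. *)
Lemma weights6 (b : 'F_5) e x y : b \in [:: 2; 3] -> classes6 b = [:: e; x; y] ->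
  [/\ nat_of_ord e.1 = 0, nat_of_ord x.1 = if (b == 2)%R then 1 else 2 &
      nat_of_ord y.1 = if (b == 2)%R then 4 else 3]%N /\
  [/\ nat_of_ord (e.1 ^+ 2 - e.2)%R = if (b == 2)%R then 3 else 2,
      nat_of_ord (x.1 ^+ 2 - x.2)%R = if (b == 2)%R then 4 else 1 &
      nat_of_ord (y.1 ^+ 2 - y.2)%R = if (b == 2)%R then 4 else 1]%N.
Proof.
rewrite !inE => /orP[] /eqP->; rewrite /classes6 /= => -[<- <- <-]; do 2?split; by vm_compute.
Qed.

Lemma sqr_le40 (x : int) : x ^+ 2 <= 40 -> -6 <= x <= 6.
Proof. by nia. Qed.

(* The terms + 0 come from sums over explicit lists of classes. *)
Lemma class_sums6 (e x y : int) : e + (x + (y + 0)) = 1 ->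
    e ^+ 2 + (x ^+ 2 + (y ^+ 2 + 0)) <= 40 -> (2 %| x + (y + 0) - 1)%Z -> (5 %| e)%Z ->
    (5 %| x - y - 1)%Z || (5 %| x - y + 1)%Z ->
  e = 0 /\ ((x = 1 /\ y = 0) \/ (x = 0 /\ y = 1)).
Proof.
move=> s1 s40 xy2 e5 xy5; have [[e2 x2] y2] := (sqr_ge0 e, sqr_ge0 x, sqr_ge0 y).
have e6 : -6 <= e <= 6 by apply: sqr_le40; lia.
have e0 : e = 0 by lia.
have Dy : y = 1 - x by lia.
have x6 : -6 <= x <= 6 by apply: sqr_le40; lia.
have : x \in [:: -4; 0; 1; 5] by rewrite !inE; lia.
(* The values x = -4 and x = 5 give a sum of squares 16 + 25 = 41, just above the bound. *)
by rewrite e0 Dy !inE => /or4P[] /eqP Dx; move: s40; rewrite e0 Dy Dx; lia.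
Qed.

Lemma sum_filter_cond (V : nmodType) (T : eqType) (r : seq T) (P Q : pred T) (F : T -> V) :
    (forall x, x \in r -> x \notin [seq y <- r | Q y] -> F x = 0) ->
  \sum_(x <- r | P x) F x = \sum_(x <- [seq y <- r | Q y] | P x) F x.
Proof.
move=> F0; rewrite big_filter_cond [RHS]big_mkcondl [LHS]big_seq_cond [RHS]big_seq_cond.
apply: eq_bigr => x /andP[xr _]; case: ifP => // nQ.
by apply: F0 => //; rewrite mem_filter nQ.
Qed.

(** The unknowns are the partial augmentations at [classes4], in that order; [v], [w] belong to the
    classes of opposite trace to [x], [y]. The last hypothesis is the product of the traces of [u]
    and of its inverse modulo 5. *)
Lemma class_sums4 (c1 c4 x y w v : int) : c1 + (c4 + (x + (y + (w + (v + 0))))) = 1 ->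
    (2 %| x + (y + (w + (v + 0))) - 1)%Z ->
    c1 + 0 = 0 \/ c1 + 0 = 1 -> c4 + 0 = 0 \/ c4 + 0 = 1 ->
    x + (v + 0) = 0 \/ x + (v + 0) = 1 -> y + (w + 0) = 0 \/ y + (w + 0) = 1 ->
    (c1 - c1) ^+ 2 + ((c4 - c4) ^+ 2 + ((x - v) ^+ 2 + ((y - w) ^+ 2 +
      ((w - y) ^+ 2 + ((v - x) ^+ 2 + 0))))) <= 80 ->
    (5 %| (0%:Z * c1 + (0%:Z * c4 + (1%:Z * x + (2%:Z * y + (3%:Z * w + (4%:Z * v + 0)))))) *
      (0%:Z * c1 + (0%:Z * c4 + (2%:Z * x + (1%:Z * y + (4%:Z * w + (3%:Z * v + 0)))))) -
          2)%Z ->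
  [/\ c1 = 0, c4 = 0 & (x, y, w, v) \in
    [:: (1, 0, 0, 0); (0, 1, 0, 0); (0, 0, 1, 0); (0, 0, 0, 1) : int * int * int * int]].
Proof.
move=> s1 odd1 d1 d4 d3 d2 s80 dv5'; have [X2 Y2] := (sqr_ge0 (x - v), sqr_ge0 (y - w)).
have s40 : (x - v) ^+ 2 + (y - w) ^+ 2 <= 40 by lia.
have dv5 : (5 %| (x + 2 * y + 3 * w + 4 * v) * (2 * x + y + 4 * w + 3 * v) - 2)%Z.
  by rewrite !mul0r !mul1r !add0r !addr0 !addrA in dv5'.
have Xb : -6 <= x - v <= 6 by apply: sqr_le40; lia.
have Yb : -6 <= y - w <= 6 by apply: sqr_le40; lia.
split; [by clear -s1 odd1 d1 d4 d3 d2; lia | by clear -s1 odd1 d1 d4 d3 d2; lia |].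
rewrite !inE !xpair_eqE.
(* By parity exactly one of x + v and y + w is 1, the other 0. The bound on squares then leaves
   finitely many (x, y), which the congruence modulo 5 sifts. *)
have [[Dv Dw]|[Dv Dw]] : (v = 1 - x /\ w = - y) \/ (v = - x /\ w = 1 - y).
  by clear -s1 odd1 d1 d4 d3 d2; lia.
  have : x \in [:: -2; -1; 0; 1; 2; 3] by rewrite !inE; clear -Xb Dv; lia.
  have : y \in [:: -3; -2; -1; 0; 1; 2; 3] by rewrite !inE; clear -Yb Dw; lia.
  rewrite !inE; move: s40 dv5; rewrite Dv Dw; clear.
  move=> s40 dv5 /or4P[/eqP|/eqP|/eqP|/or4P[/eqP|/eqP|/eqP|/eqP]] Dy;
    move=> /or4P[/eqP|/eqP|/eqP|/or3P[/eqP|/eqP|/eqP]] Dx;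
    by move: s40 dv5; rewrite Dx Dy; lia.
have : x \in [:: -3; -2; -1; 0; 1; 2; 3] by rewrite !inE; clear -Xb Dv; lia.
have : y \in [:: -2; -1; 0; 1; 2; 3] by rewrite !inE; clear -Yb Dw; lia.
rewrite !inE; move: s40 dv5; rewrite Dv Dw; clear.
move=> s40 dv5 /or4P[/eqP|/eqP|/eqP|/or3P[/eqP|/eqP|/eqP]] Dy;
  move=> /or4P[/eqP|/eqP|/eqP|/or4P[/eqP|/eqP|/eqP|/eqP]] Dx;
  by move: s40 dv5; rewrite Dx Dy; lia.
Qed.

(** The classes with fourth power 1: two of PGL-order 2, then four of PGL-order 4. *)
Definition classes4 : seq ('F_5 * 'F_5) := [:: (0, 1); (0, 4); (1, 3); (2, 2); (3, 2); (4, 3)].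

Lemma cls4_ind (P : 'F_5 * 'F_5 -> Prop) :
  P (0, 1) -> P (0, 4) -> P (1, 3) -> P (2, 2) -> P (3, 2) -> P (4, 3) ->
  {in classes4, forall td, P td}.
Proof.
move=> P1 P4 Px Py Pw Pv td; rewrite !inE.
by move=> /or4P[/eqP->|/eqP->|/eqP->|/or3P[] /eqP->].
Qed.

Lemma cls4_single (f : 'F_5 * 'F_5 -> int) : f (0, 1) = 0 -> f (0, 4) = 0 ->
    (f (1, 3), f (2, 2), f (3, 2), f (4, 3)) \in
    [:: (1, 0, 0, 0); (0, 1, 0, 0); (0, 0, 1, 0); (0, 0, 0, 1) : int * int * int * int] ->
  exists2 c, c \in classes4 & f c = 1 /\ {in classes4, forall td, td != c -> f td = 0}.
Proof.
move=> f1 f4; rewrite !inE !xpair_eqE.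
case/or4P=> /andP[/andP[/andP[/eqP fx /eqP fy] /eqP fw] /eqP fv];
  [exists (1, 3)|exists (2, 2)|exists (3, 2)|exists (4, 3)] => //;
  by split=> //; apply: (@cls4_ind (fun td => td != _ -> f td = 0)) => // /eqP.
Qed.

Lemma supp_4 : [/\ power_params 4 1 = classes4, nonscalar_pow 2 (power_params 4 1) = drop 2
    classes4 &
  {in drop 2 classes4, forall c, pow_tr 2 c.1 c.2 = 0 /\
    [seq td <- power_params 4 1 | pow_class 2 td == pow_class 2 c] = drop 2 classes4}].
Proof.
split; try by apply/eqP; vm_compute.
by move=> c; rewrite !inE => /or4P[] /eqP->; split; apply/eqP; vm_compute.
Qed.

Lemma det_supp_4 : [/\ [seq td <- power_params 4 1 | td.2 == 1] = [:: (0, 1)],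
  [seq td <- power_params 4 1 | td.2 == 4] = [:: (0, 4)],
  [seq td <- power_params 4 1 | td.2 == 3] = [:: (1, 3); (4, 3)] &
  [seq td <- power_params 4 1 | td.2 == 2] = [:: (2, 2); (3, 2)]].
Proof. by split; apply/eqP; vm_compute. Qed.

(** An element of PGL-order 4 has distinct eigenvalues in F_5, whose fourth powers are 1. *)
Lemma supp_4_empty (b : 'F_5) : b != 1 -> nonscalar_pow 2 (power_params 4 b) = [::].
Proof. by move=> b1; apply/eqP; move: b1; elim/F5P: b; vm_compute. Qed.

(** The traces of g and, as t / d, of g^-1. *)
Lemma weights4 : [seq nat_of_ord td.1 | td : 'F_5 * 'F_5 <- classes4] = [:: 0; 0; 1; 2; 3;
    4]%N /\
  [seq nat_of_ord (td.1 / td.2) | td : 'F_5 * 'F_5 <- classes4] = [:: 0; 0; 2; 1; 4; 3]%N.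
Proof. by vm_compute. Qed.

Lemma opp_cls4 : [seq (- td.1, td.2) | td : 'F_5 * 'F_5 <- classes4] =
  [:: (0, 1); (0, 4); (4, 3); (3, 2); (2, 2); (1, 3)].
Proof. by apply/eqP; vm_compute. Qed.

Lemma sum_map_weight (w : 'F_5 * 'F_5 -> 'F_5) (c : 'F_5 * 'F_5 -> int) s :
  \sum_(td <- s) (nat_of_ord (w td))%:Z * c td =
  \sum_(mc <- zip [seq nat_of_ord (w td) | td <- s] [seq c td | td <- s]) mc.1%:Z * mc.2.
Proof. by elim: s => [|td s IHs]; rewrite ?big_nil //= !sum_cons IHs. Qed.

(* For eigenvalues r, s: r ^+ 2 = - s ^+ 2 and r ^+ 4 = s ^+ 4 = 1, whence    *)
(* (r + s) * (r ^+ 3 + s ^+ 3) = 2 + r * s * (r ^+ 2 + s ^+ 2) = 2.           *)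
Lemma std4_trace (t d : 'F_5) : pow_tr 2 t d = 0 -> pow_tr 4 t d = 2 ->
  t * pow_tr 3 t d = 2.
Proof.
move=> /eqP D2 /eqP D4; apply/eqP; apply: contraTT D2 => nt; move: D4 nt.
by elim/F5P: t; elim/F5P: d; vm_compute.
Qed.

Lemma F5_eqz (x : int) (b : 'F_5) : (x%:~R == b) = (5 %| x - (nat_of_ord b)%:Z)%Z.
Proof. by rewrite -[in LHS](natr_Zp b) -[b%:R]/(b%:~R) (eqz_Fp x b). Qed.

Lemma F5_numE : ((nat_of_ord (1 : 'F_5) = 1%N) * (nat_of_ord (2 : 'F_5) = 2%N) *
  (nat_of_ord (3 : 'F_5) = 3%N) * (nat_of_ord (4 : 'F_5) = 4%N))%type.
Proof. by do ?split; vm_compute. Qed.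

Lemma cls6_3 (b : 'F_5) : exists e x y, classes6 b = [:: e; x; y].
Proof. by rewrite /classes6; case: ifP => _; do 3!eexists. Qed.

Lemma mxtrace_sqr6 (b : 'F_5) (C : 'M['F_5]_3) : b \in [:: 2; 3] -> \tr (C ^+ 2) = 0 ->
  \tr (C ^+ 3) = - b ^+ 3 -> C ^+ 6 = (b ^+ 2)%:M -> \tr C = if b == 2 then 4 else 1.
Proof.
move=> b23 C2 C3 C6; have [be [ga rec]] := mxtrace_recurrence3 C.
have C7 : C ^+ 7 = b ^+ 2 *: C by rewrite exprS C6 -mulmxE mul_mx_scalar.
have C8 : C ^+ 8 = b ^+ 2 *: C ^+ 2 by rewrite exprS C7 -scalerAr.
move: (rec 0%N) (rec 1%N) (rec 2%N) (rec 3%N) (rec 4%N) (rec 5%N).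
rewrite C8 C7 C6 !mxtraceZ C2 C3 expr1 !mxtrace_scalar => r0 r1 r2 r3 r4 r5.
exact: (sqr6_trace b23 (erefl _) r0 r1 r2 r3 r4 r5).
Qed.

Lemma tr5V x : tr5 x^-1%g = tr5 x / det5 x.
Proof. by rewrite /tr5 GLmxV mxtrace_inv22 ?GLmx_unit. Qed.

(** * Torsion units of Z[GL(2, 5)] *)

Section MinimalPower.
Variables (u : groupRing int GL25) (n k : nat) (z : GL25) (a : 'F_5).
Hypotheses (n_gt0 : (0 < n)%N) (un : u ^+ n = 1) (u1 : augment u = 1).
Hypotheses (k_gt1 : (1 < k)%N) (za : GLmx z = a%:M) (uk : u ^+ k = gr_of int z).
Hypothesis k_min : forall j y, (0 < j < k)%N -> scalarGL y -> u ^+ j <> gr_of int y.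
Hypothesis u_pow : forall p, prime p -> (p %| k)%N ->
  forall m, exists h, same_eps (u ^+ (p * m)) h.
Implicit Types (g h x y : GL25) (t d : 'F_5) (td : 'F_5 * 'F_5).

Lemma sc_z : scalarGL z. Proof. by rewrite /scalarGL za scalar_mx_is_scalar. Qed.

(** By Berman-Higman a nonzero central coefficient would make [u] itself scalar, against k > 1. *)
Lemma coef_sc y : scalarGL y -> u y = 0.
Proof.
move=> scy; apply/eqP; apply: contraT => uy.
have := central_coef1 n_gt0 un u1 (sc_central scy) uy.
by rewrite -[u]expr1 => /k_min; case.
Qed.

Lemma param_eps_supp td : td \in class_params -> td \notin power_params k a -> param_eps u td
    = 0.
Proof.
case: td => t d; rewrite mem_filter => d0; rewrite d0 andbT.
move: d0; rewrite mem_class_params /= => d0; apply: contraNeq => utd.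
have := eps_power_central (ltnW k_gt1) (sc_central sc_z) uk utd.
move/(congr1 GLmx); rewrite GLmxX (GLmx_comp t d0) za pow_coefE.
rewrite tr_companion det_companion; case: (pow_coef k t d) => c b /= Dz.
have := scalar_comb c b (companion_not_scalar t d).
rewrite Dz scalar_mx_is_scalar => /esym/eqP c0; move: Dz; rewrite c0 scale0r add0r.
by move/matrixP/(_ 0 0); rewrite !mxE !mulr1n => ->.
Qed.

Lemma sum_supp_cond (V : nmodType) (P : pred ('F_5 * 'F_5)) (F : 'F_5 * 'F_5 -> V) :
    (forall td, param_eps u td = 0 -> F td = 0) ->
  \sum_(td <- class_params | P td) F td = \sum_(td <- power_params k a | P td) F td.
Proof.
by move=> F0; apply: sum_filter_cond => td clt nsupp; apply/F0/param_eps_supp.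
Qed.

Lemma sum_supp (V : zmodType) (f : GL25 -> V) : (forall x y, f (x ^ y)%g = f x) ->
  \sum_x f x *~ u x = \sum_(td <- power_params k a) f (companionGL td.1 td.2) *~ param_eps u td.
Proof.
move=> fJ; rewrite (sum_param_eps coef_sc fJ) sum_supp_cond // => td ->.
by rewrite mulr0z.
Qed.

Lemma sum_supp1 : \sum_(td <- power_params k a) param_eps u td = 1.
Proof.
rewrite -u1 /augment; under [RHS]eq_bigr do rewrite -[u _]intz.
by rewrite (@sum_supp _ (fun=> 1)) //; apply: eq_bigr => td _; rewrite intz.
Qed.

Lemma sum_supp_det : exists d0, forall d, d != 0 ->
  \sum_(td <- power_params k a | td.2 == d) param_eps u td = (d == d0)%:R.
Proof.
have [d0 Hd0] := det_sums n_gt0 un u1 coef_sc; exists d0 => d nd.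
by rewrite -Hd0 // sum_supp_cond.
Qed.

Lemma supp_uniq : uniq (power_params k a). Proof. exact: filter_uniq. Qed.

Lemma supp_sub : {subset power_params k a <= class_params}.
Proof. by move=> td; rewrite mem_filter => /andP[]. Qed.

Lemma sum_supp_sqr : \sum_(td <- power_params k a) param_eps u td ^+ 2 <= 40.
Proof. exact: (sum_param_eps_sqr n_gt0 un u1 coef_sc supp_uniq supp_sub). Qed.

Lemma sum_supp_odd_sqr :
  \sum_(td <- power_params k a) (param_eps u td - param_eps u (- td.1, td.2)) ^+ 2 <= 80.
Proof. exact: (sum_param_eps_odd_sqr n_gt0 un u1 coef_sc supp_uniq supp_sub). Qed.

Lemma supp_same_eps td0 : td0 \in power_params k a -> param_eps u td0 = 1 ->
  {in power_params k a, forall td, td != td0 -> param_eps u td = 0} -> same_eps u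
      (companionGL td0.1 td0.2).
Proof.
case: td0 => t0 d0 s0 e1 e0; have := supp_sub s0; rewrite mem_class_params /= => d00.
apply: same_eps_comp => [//||t d nd]; first exact: coef_sc.
rewrite -xpair_eqE; have [[-> ->] //|ne] := eqVneq (t, d) (t0, d0).
have [sd|nsd] := boolP ((t, d) \in power_params k a); first exact: (e0 (t, d) sd ne).
by apply: (@param_eps_supp (t, d)); rewrite ?mem_class_params.
Qed.

Lemma unit_powX1 j : (u ^+ j) ^+ n = 1.
Proof. by rewrite -exprM mulnC exprM un expr1n. Qed.

Lemma same_eps_not_sc j h : (0 < j < k)%N -> same_eps (u ^+ j) h -> ~~ scalarGL h.
Proof.
move=> jk uh; apply/negP => sch; apply: (k_min jk sch).
exact: same_eps_central n_gt0 (unit_powX1 j) (sc_central sch) uh.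
Qed.

Lemma power_rep p : prime p -> (p %| k)%N -> exists h, forall j,
  same_eps (u ^+ (p * j)) (h ^+ j)%g.
Proof.
move=> p_pr pk; have [h uh] := u_pow p_pr pk 1; rewrite muln1 in uh.
exists h => j; rewrite exprM; apply: same_eps_exp => // m.
by have [h' uh'] := u_pow p_pr pk m; exists h'; rewrite -exprM.
Qed.

(** u^p matches a nonscalar h, and some h^j with j <= 6 is scalar; minimality of [k] forces k <= p
    j. *)
Lemma power_bound p : prime p -> (p %| k)%N -> (p < k)%N -> (k <= 6 * p)%N.
Proof.
move=> p_pr pk p_lt; have [h uh] := power_rep p_pr pk.
have p_gt0 := prime_gt0 p_pr; have := uh 1%N; rewrite muln1 expg1 => uph.
have nsc : ~~ scalarGL h by apply: same_eps_not_sc uph; rewrite p_gt0.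
have [j /andP[j_gt1 j_le6] schj] := sc_exp_le6 nsc; rewrite leqNgt; apply/negP => k_gt.
have pj : (0 < p * j < k)%N by nia.
by have := same_eps_not_sc pj (uh j); rewrite schj.
Qed.

(** With h matching u^p, the congruence for p-th powers says that the classes whose p-th power is
    conjugate to h have total 1 modulo p. So one such class lies in the support, and its powers are
    scalar exactly when those of h are. *)
Lemma prime_power_sum p : prime p -> (p %| k)%N -> (p < k)%N ->
  exists h td0, [/\ td0 \in power_params k a,
    tr5 h = pow_tr p td0.1 td0.2 /\ det5 h = td0.2 ^+ p,
    forall j, same_eps (u ^+ (p * j)) (h ^+ j)%g,
    forall j, (0 < p * j < k)%N -> (pow_coef (p * j) td0.1 td0.2).1 != 0 &
    (p %| \sum_(td <- [seq td <- power_params k a | pow_class p td == pow_class p td0])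
        param_eps u td - 1)%Z].
Proof.
move=> p_pr pk p_lt; have [h uh] := power_rep p_pr pk; exists h.
have p_gt0 := prime_gt0 p_pr; have := uh 1%N; rewrite muln1 expg1 => uph.
have nsc : ~~ scalarGL h by apply: same_eps_not_sc uph; rewrite p_gt0.
have := eps_exp_prime u h p_pr; rewrite uph eps_gr_of class_refl.
rewrite sum_supp => [|x y]; last by rewrite exp_class_invariant.
have cE td : td \in power_params k a -> ((companionGL td.1 td.2 ^+ p)%g \in (h ^: [set:
    GL25])%g) =
    (pow_class p td == (true, tr5 h, det5 h)).
  case: td => t d /supp_sub; rewrite mem_class_params /= => d0.
  have /class_eqP <- : (companionGL (tr5 h) (det5 h)) \in (h ^: [set: GL25])%g.
    by rewrite class_sym class_comp ?det5_neq0 // nsc !eqxx.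
  rewrite class_comp ?det5_neq0 // tr5X det5X (tr5_comp t d0) (det5_comp t d0).
  rewrite (sc_exp p (comp_not_sc t d0)) (tr5_comp t d0) (det5_comp t d0).
  by rewrite /pow_class !xpair_eqE /= eqb_id andbA.
rewrite big_seq; under eq_bigr => td tds do rewrite (cE td tds).
rewrite -big_seq => sum1.
have /hasP[td0 td0s Dtd0] : has (fun td => pow_class p td == (true, tr5 h, det5 h))
    (power_params k a).
  apply: contraT => /hasPn none; move/eqP: sum1; rewrite big_seq big1 ?oner_eq0 //.
  by move=> td /none/negPf->; rewrite mul0rz.
have [pc0 Dtr Ddet] := eqP Dtd0.
exists td0; split=> //.
  move=> j pj; have d0 : td0.2 != 0 by rewrite -mem_class_params supp_sub.
  have nc := comp_not_sc td0.1 d0.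
  have ncp : ~~ scalarGL (companionGL td0.1 td0.2 ^+ p)%g.
    by rewrite (sc_exp p nc) (tr5_comp td0.1 d0) (det5_comp td0.1 d0).
  have := same_eps_not_sc pj (uh j); rewrite (comp_exp_conj nsc d0 ncp Dtr Ddet).
  by rewrite (sc_exp _ nc) (tr5_comp td0.1 d0) (det5_comp td0.1 d0).
rewrite -eqz_Fp // rmorph_sum /= big_filter (eqP Dtd0) mulr1z; apply/eqP.
apply: etrans (etrans (esym sum1) (mulr1z _)); rewrite [LHS]big_mkcond.
by apply: eq_bigr => td _; case: ifP => _; rewrite ?mul0rz.
Qed.

Lemma det_sum01 d : d != 0 ->
  \sum_(td <- [seq td <- power_params k a | td.2 == d]) param_eps u td = 0 \/
  \sum_(td <- [seq td <- power_params k a | td.2 == d]) param_eps u td = 1.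
Proof.
by move=> nd; have [d0 Hd] := sum_supp_det; rewrite big_filter Hd //; case: (d == d0);
    [right|left].
Qed.

Lemma prime_power_case p m :
    [&& prime p, p %| k, p < k, p %| m, 0 < m & m < k]%N ->
  exists h td0, [/\ td0 \in nonscalar_pow m (power_params k a),
    tr5 h = pow_tr p td0.1 td0.2, det5 h = td0.2 ^+ p,
    forall j, same_eps (u ^+ (p * j)) (h ^+ j)%g &
    (p %| \sum_(td <- [seq td <- power_params k a | pow_class p td == pow_class p td0])
        param_eps u td - 1)%Z].
Proof.
case/and5P=> p_pr pk p_lt /dvdnP[j ->]; rewrite mulnC => mk.
have [h [td0 [s0 [Dtr Ddet] uh nsc dvp]]] := prime_power_sum p_pr pk p_lt.
by exists h, td0; split=> //; rewrite mem_filter s0 nsc.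
Qed.

Lemma nonscalar_pow_neq0 p m : [&& prime p, p %| k, p < k, p %| m, 0 < m & m < k]%N ->
  nonscalar_pow m (power_params k a) <> [::].
Proof. by move=> Hpm E0; have [h [td0 []]] := prime_power_case Hpm; rewrite E0. Qed.

Lemma supp_neq0 : power_params k a <> [::].
Proof. by move=> E0; have := sum_supp1; rewrite E0 big_nil. Qed.

Lemma prime235_same_eps : k \in [:: 2; 3; 5]%N -> exists g, same_eps u g.
Proof.
move=> /(allP (size_supp235 a)); case E0: (power_params k a) supp_neq0 => [|td [|//]] // _ _.
exists (companionGL td.1 td.2); apply: supp_same_eps; rewrite ?E0 ?mem_head //.
  by have := sum_supp1; rewrite E0 big_seq1.
by move=> td'; rewrite inE => ->.
Qed.

(* No element of PGL(2, 5) has prime order exceeding 6. *)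
Lemma prime_power_le6 : prime k -> (k <= 6)%N.
Proof.
move=> k_pr; rewrite leqNgt; apply/negP => k_gt6.
case E0: (power_params k a) supp_neq0 => [|td s] // _.
have : td \in power_params k a by rewrite E0 mem_head.
rewrite mem_filter mem_class_params => /andP[/eqP pk d0].
have nc := comp_not_sc td.1 d0.
have sck : scalarGL (companionGL td.1 td.2 ^+ k)%g.
  by rewrite (sc_exp _ nc) (tr5_comp _ d0) (det5_comp _ d0) pk.
have [j j26 scj] := sc_exp_le6 nc; case/negP: nc.
apply: sc_coprime scj sck; last by lia.
by rewrite coprime_sym prime_coprime // gtnNdvd //; lia.
Qed.

Lemma z_scalar_neq0 : a != 0.
Proof.
have := GLmx_unit z; rewrite za unitmxE det_scalar unitfE.
by apply: contraNneq => ->; rewrite expr0n.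
Qed.

Lemma power15_excluded : k <> 15%N.
Proof.
move=> k15; have [x [y [Dxy [Dx Cx] [Dy Cy]]]] := supp15 z_scalar_neq0.
have := @prime_power_case 3 3; rewrite k15 => /(_ isT) [h [td0 [t0 _ _ _]]].
move: t0; rewrite Dx inE => /eqP->; rewrite Cx big_seq1 => /dvdzP[q3 Dq3].
have := @prime_power_case 5 5; rewrite k15 => /(_ isT) [h' [td0' [t0' _ _ _]]].
move: t0'; rewrite Dy inE => /eqP->; rewrite Cy big_seq1 => /dvdzP[q5 Dq5].
have := sum_supp1; have := sum_supp_sqr; rewrite k15 !(perm_big _ Dxy) /=.
rewrite !sum_cons !big_nil; move: (param_eps u x) (param_eps u y) Dq3 Dq5 => e1 e2.
(* The partial augmentation e1 is 1 modulo 3 and, since e2 = 1 - e1 is 1 modulo 5, divisible by 5.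
   The smallest candidates -5 and 10 already violate the bound on squares. *)
clear; move=> D3 D5 b40 e12; have [m Dm] : exists m, e1 = 10 + 15 * m.
  by exists ((e1 - 10) %/ 15)%Z; lia.
have : (m <= -1) || (0 <= m) by lia.
by nia.
Qed.

(** The partial augmentation at the involution class is even by the congruence modulo 2, and 0 or 1
    by the determinant; so it is 0, while the congruence modulo q makes it 1 modulo q. *)
Lemma power_2q_excluded : (k, a) \in [:: (6%N, 1); (6%N, 4); (10%N, 1); (10%N, 4)] -> False.
Proof.
move=> ka; have [q kqa] : exists q, (k, q, a) \in
    [:: (6%N, 3%N, 1); (6%N, 3%N, 4); (10%N, 5%N, 1); (10%N, 5%N, 4)].
  by exists k./2; move: ka; rewrite !inE => /or4P[] /eqP[-> ->].
have [e [x [y [Ds [D2 C2] [Dq Cq] [e0 Ce]]]]] := supp_2q kqa.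
have k2q : [&& prime 2, 2 %| k, 2 < k, 2 %| 2, 0 < 2 & 2 < k]%N /\
    [&& prime q, q %| k, q < k, q %| q, 0 < q & q < k]%N /\ (2 < q)%N.
  by move: kqa; rewrite !inE => /or4P[] /eqP[-> -> _].
have [k2 [kq q_gt2]] := k2q.
have [h [td0 [t0 _ _ _]]] := prime_power_case k2.
rewrite D2 in t0; rewrite C2 // => /dvdzP[q2 Dq2].
have [h' [td0' [t0' _ _ _]]] := prime_power_case kq.
rewrite Dq inE in t0'; rewrite (eqP t0') Cq => /dvdzP[r Dr].
have := sum_supp1; have := det_sum01 e0; rewrite Ce Ds.
move: Dq2 Dr; rewrite !sum_cons !big_nil.
move: (param_eps u x) (param_eps u y) (param_eps u e) => cx cy c; clear -q_gt2.
move=> D2 Dr c01 sum1; case: c01 => c01; last by lia.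
have [r_ge0|r_le] : 0 <= r \/ r <= -1 by lia.
  have : 0 <= r * q by rewrite mulr_ge0.
  lia.
have : 0 <= (- 1 - r) * (q%:Z - 3) by rewrite mulr_ge0; lia.
lia.
Qed.

Lemma power10_excluded : k <> 10%N.
Proof.
move=> k10; have := F5_neq0 z_scalar_neq0; rewrite !inE => /or4P[] /eqP Da.
- by apply: power_2q_excluded; rewrite k10 Da !inE eqxx.
- have := @nonscalar_pow_neq0 2 2; rewrite k10 => /(_ isT); apply; apply: supp_10.
  by rewrite Da !inE.
- have := @nonscalar_pow_neq0 2 2; rewrite k10 => /(_ isT); apply; apply: supp_10.
  by rewrite Da !inE.
by apply: power_2q_excluded; rewrite k10 Da !inE eqxx ?orbT.
Qed.

Lemma power_8_9_25_excluded : k \notin [:: 8; 9; 25]%N.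
Proof.
have [E8 E9 E25] := supp_empty a.
apply/negP; rewrite !inE => /or3P[] /eqP Dk.
- have := @nonscalar_pow_neq0 2 4; rewrite Dk => /(_ isT); apply; exact: E8.
- have := @nonscalar_pow_neq0 3 3; rewrite Dk => /(_ isT); apply; exact: E9.
have := @nonscalar_pow_neq0 5 5; rewrite Dk => /(_ isT); apply; exact: E25.
Qed.

Lemma power12_excluded : k <> 12%N.
Proof.
move=> k12; have := @prime_power_sum 2; rewrite k12 => /(_ isT isT isT).
case=> h [td0 [t0 _ _ nsc _]]; have := allP (supp_12 a) td0 t0.
by rewrite (negPf (nsc 2 isT)) (negPf (nsc 3 isT)).
Qed.

Definition std_mx := gr_ext GLmx u.
Definition sym2_mx := gr_ext GLsym2 u.

Lemma stdX j : std_mx ^+ j = gr_ext GLmx (u ^+ j).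
Proof. by rewrite gr_extX // => x y; exact: GLmxM. Qed.

Lemma sqrX j : sym2_mx ^+ j = gr_ext GLsym2 (u ^+ j).
Proof. by rewrite gr_extX; [|exact: GLsym2_1|exact: GLsym2M]. Qed.

Lemma stdXk : std_mx ^+ k = a%:M.
Proof. by rewrite stdX uk gr_ext_of. Qed.

Lemma sqrXk : sym2_mx ^+ k = (a ^+ 2)%:M.
Proof. by rewrite sqrX uk gr_ext_of /GLsym2 za sym2_scalar. Qed.

Lemma tr_stdX j h : same_eps (u ^+ j) h -> \tr (std_mx ^+ j) = tr5 h.
Proof. by move=> uh; rewrite stdX (same_eps_mxtrace _ uh) // => x y; exact: tr5J. Qed.

Lemma tr_sqrX j h : same_eps (u ^+ j) h -> \tr (sym2_mx ^+ j) = tr5 h ^+ 2 - det5 h.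
Proof. by move=> uh; rewrite sqrX (same_eps_mxtrace tr_GLsym2J uh) tr_GLsym2. Qed.

Lemma sum_supp_weight (f : GL25 -> 'F_5) (w : 'F_5 * 'F_5 -> 'F_5) :
    (forall x y, f (x ^ y)%g = f x) -> (forall x, f x = w (tr5 x, det5 x)) ->
  \sum_x f x *~ u x = (\sum_(td <- power_params k a) (nat_of_ord (w td))%:Z * param_eps u
      td)%:~R.
Proof.
move=> fJ fw; rewrite sum_supp // rmorph_sum /= !big_seq; apply: eq_bigr => -[t d].
move/supp_sub; rewrite mem_class_params /= => d0.
rewrite fw (tr5_comp t d0) (det5_comp t d0) rmorphM /=.
by rewrite -[in LHS](natr_Zp (w (t, d))) -mulrzr.
Qed.

Lemma tr_std : \tr std_mx = (\sum_(td <- power_params k a) (nat_of_ord td.1)%:Z * param_eps u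
    td)%:~R.
Proof. by rewrite mxtrace_ext (@sum_supp_weight _ fst) //; exact: tr5J. Qed.

Lemma tr_sqr :
  \tr sym2_mx = (\sum_(td <- power_params k a) (nat_of_ord (td.1 ^+ 2 - td.2))%:Z * param_eps
      u td)%:~R.
Proof.
rewrite mxtrace_ext (@sum_supp_weight _ (fun td => td.1 ^+ 2 - td.2)).
- by [].
- exact: tr_GLsym2J.
exact: tr_GLsym2.
Qed.

Lemma power6_nonsquare_same_eps : k = 6%N -> a \in [:: 2; 3] -> exists g, same_eps u g.
Proof.
move=> k6 a23; have [Ds D2 C2 C3] := supp_6 a23.
have := @prime_power_case 2 2; rewrite {1 2 3}k6 => /(_ isT).
case=> h2 [t2 [t2s tr2 det2 uh2 dv2]].
have := @prime_power_case 3 3; rewrite {1 2 3}k6 => /(_ isT).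
case=> h3 [t3 [t3s tr3 det3 uh3 _]].
move: t2s; rewrite k6 D2 => /C2[Dtr2 [Ddet2 Cl2]].
have {}t3s : t3 \in classes6 a by move: t3s; rewrite k6 mem_filter Ds => /andP[].
have [Dtr3 Ddet3] := C3 _ t3s.
rewrite k6 Cl2 in dv2; rewrite Dtr2 in tr2; rewrite Ddet2 in det2.
rewrite Dtr3 in tr3; rewrite Ddet3 in det3.
have := uh2 1%N; have := uh3 1%N; rewrite !muln1 !expg1 => e3 e2.
have std2 := tr_stdX e2; have std3 := tr_stdX e3.
have sqr2 := tr_sqrX e2; have sqr3 := tr_sqrX e3.
rewrite tr2 in std2 sqr2; rewrite tr3 in std3 sqr3.
rewrite det2 subrr in sqr2; rewrite det3 expr0n sub0r in sqr3.
have std6 := stdXk; rewrite k6 in std6; move/(congr1 mxtrace): std6 => std6.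
have sqr6 := sqrXk; rewrite k6 in sqr6.
(* The powers u^2 and u^3 match known classes, which fixes enough traces of powers to restrict the
   trace of [u] in both representations. *)
have tstd : \tr std_mx \in (if a == 2 then [:: 1; 4] else [:: 2; 3]).
  apply: (std6_trace a23 (d := \det std_mx)); rewrite -pow_trE //.
  by rewrite std6 mxtrace_scalar.
have tsqr := mxtrace_sqr6 a23 sqr2 sqr3 sqr6.
have s1 := sum_supp1; have s40 := sum_supp_sqr.
rewrite tr_std in tstd; rewrite tr_sqr in tsqr.
rewrite k6 Ds in s1 s40 tstd tsqr.
have [e [x [y Dc]]] := cls6_3 a.
have [[w1 w2 w3] [v1 v2 v3]] := weights6 a23 Dc.
rewrite Dc !sum_cons !big_nil in s1 s40 tstd tsqr dv2.
rewrite w1 w2 w3 in tstd; rewrite v1 v2 v3 in tsqr.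
have [e0 xy01] : param_eps u e = 0 /\ (param_eps u x = 1 /\ param_eps u y = 0 \/ param_eps u
    x = 0 /\ param_eps u y = 1).
  move: tstd tsqr; case: ifP => _; rewrite !inE.
    move=> tstd /eqP tsqr; rewrite !F5_eqz !F5_numE in tstd tsqr.
    by apply: class_sums6 => //; move: tstd tsqr; lia.
  move=> tstd /eqP tsqr; rewrite !F5_eqz !F5_numE in tstd tsqr.
  by apply: class_sums6 => //; move: tstd tsqr; lia.
have Dk : power_params k a = [:: e; x; y] by rewrite k6 Ds.
have [] := xy01 => -[cx cy].
  exists (companionGL x.1 x.2); apply: supp_same_eps cx _; first by rewrite Dk !inE eqxx orbT.
  move=> td; rewrite Dk !inE => /or3P[] /eqP-> ne; [exact: e0 | | exact: cy].
  case/negP: ne; exact: eqxx.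
exists (companionGL y.1 y.2); apply: supp_same_eps cy _; first by rewrite Dk !inE eqxx !orbT.
move=> td; rewrite Dk !inE => /or3P[] /eqP-> ne; [exact: e0 | exact: cx |].
case/negP: ne; exact: eqxx.
Qed.

Lemma power6_same_eps : k = 6%N -> exists g, same_eps u g.
Proof.
move=> k6; have := F5_neq0 z_scalar_neq0; rewrite !inE => /or4P[] /eqP Da.
- by exfalso; apply: power_2q_excluded; rewrite k6 Da !inE eqxx.
- by apply: power6_nonsquare_same_eps; rewrite ?Da.
- by apply: power6_nonsquare_same_eps; rewrite ?Da.
by exfalso; apply: power_2q_excluded; rewrite k6 Da !inE eqxx orbT.
Qed.

Lemma power4_same_eps : k = 4%N -> exists g, same_eps u g.
Proof.
move=> k4; have [a1|a_neq1] := eqVneq a 1; last first.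
  have := @nonscalar_pow_neq0 2 2; rewrite k4 => /(_ isT) []; exact: supp_4_empty.
have u4 : u ^+ 4 = 1.
  by rewrite -k4 uk -gr_of1; congr gr_of; apply: GLmx_inj; rewrite za a1 GLmx1.
have [Ds D2 C2] := supp_4; have [d1 d4 d3 d2] := det_supp_4.
have := @prime_power_case 2 2; rewrite {1 2 3}k4 => /(_ isT).
case=> h [t2 [t2s tr2 _ uh dv2]].
move: t2s; rewrite k4 a1 D2 => /C2[Dtr2 Cl2]; rewrite k4 a1 Cl2 in dv2.
rewrite Dtr2 in tr2; have := uh 1%N; rewrite muln1 expg1 => uh2.
have std2 := tr_stdX uh2; rewrite tr2 in std2.
have std4 := stdXk; rewrite k4 a1 in std4; move/(congr1 mxtrace): std4 => std4.
rewrite mxtrace_scalar pow_trE in std4; rewrite pow_trE in std2.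
(* Here u^3 is the inverse of [u], so its trace is again linear in the partial augmentations of
   [u]. *)
have tr3 : \tr (std_mx ^+ 3) =
    (\sum_(td <- power_params k a) (nat_of_ord (td.1 / td.2))%:Z * param_eps u td)%:~R.
  rewrite stdX mxtrace_ext -[LHS]/(\sum_x tr5 x *~ (u ^+ 3) x) (sum_inverse tr5J u4).
  apply: (@sum_supp_weight _ (fun td => td.1 / td.2)); last exact: tr5V.
  by move=> x y; rewrite -conjVg; exact: tr5J.
have trP := std4_trace std2 std4; rewrite -pow_trE tr3 tr_std in trP.
have [w1 w2] := weights4; rewrite k4 a1 Ds in trP.
rewrite (@sum_map_weight fst) (@sum_map_weight (fun td => td.1 / td.2)) w1 w2 in trP.
have s1 := sum_supp1; have so := sum_supp_odd_sqr; rewrite k4 a1 Ds in s1 so.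
have D1 := @det_sum01 1 isT; have D4 := @det_sum01 4 isT.
have D3 := @det_sum01 3 isT; have D2' := @det_sum01 2 isT.
rewrite k4 a1 d1 in D1; rewrite k4 a1 d4 in D4.
rewrite k4 a1 d3 in D3; rewrite k4 a1 d2 in D2'.
have so' : \sum_(cc <- zip [seq param_eps u td | td <- classes4]
    [seq param_eps u td | td <- [seq (- td.1, td.2) | td : 'F_5 * 'F_5 <- classes4]]) (cc.1 -
        cc.2) ^+ 2 <= 80.
  apply: le_trans so; rewrite le_eqVlt; apply/orP; left; apply/eqP.
  by elim: classes4 => [|td s IHs]; rewrite ?big_nil //= !sum_cons IHs.
rewrite opp_cls4 in so'.
have Dm : [seq param_eps u td | td <- classes4] = [:: param_eps u (0, 1); param_eps u (0, 4);
    param_eps u (1, 3);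
  param_eps u (2, 2); param_eps u (3, 2); param_eps u (4, 3)] by [].
rewrite Dm in trP so'; rewrite /classes4 /drop in dv2; rewrite /classes4 in s1.
have Dk : power_params k a = classes4 by rewrite k4 a1.
rewrite /= !sum_cons !big_nil in trP so' dv2 s1 D1 D4 D3 D2'.
move/eqP: trP; rewrite -rmorphM F5_eqz F5_numE => trP.
have [c10 c40 xywv] := class_sums4 s1 dv2 D1 D4 D3 D2' so' trP.
have [c cs [c1 c0]] := cls4_single c10 c40 xywv.
by exists (companionGL c.1 c.2); apply: supp_same_eps c1 _; rewrite Dk.
Qed.

(** For the least prime p dividing a composite k, p^2 <= k <= 6 p gives k <= 36; the bound for every
    prime divisor then leaves the list. *)
Lemma composite_exponent : ~~ prime k -> k \in [:: 4; 6; 8; 9; 10; 12; 15; 25]%N.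
Proof.
move=> npk; have pd_pr := pdiv_prime k_gt1.
have sq_le : (pdiv k ^ 2 <= k)%N.
  rewrite leqNgt; apply: contra npk; exact: (ltn_pdiv2_prime (ltnW k_gt1)).
have lt_k p : p \in primes k -> (k <= 6 * p)%N.
  rewrite mem_primes => /and3P[p_pr _ pk].
  apply: power_bound => //; rewrite ltn_neqAle dvdn_leq ?(ltnW k_gt1) // andbT.
  by apply: contraNneq npk => <-.
have k36 : (k <= 36)%N.
  have := lt_k (pdiv k); rewrite mem_primes pd_pr (ltnW k_gt1) pdiv_dvd => /(_ isT).
  nia.
have /allP/(_ k) : all (fun m => [|| prime m, ~~ all (fun p => m <= 6 * p)%N (primes m) |
    m \in [:: 4; 6; 8; 9; 10; 12; 15; 25]%N]) (iota 2 35) by vm_compute.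
rewrite mem_iota (negPf npk) k_gt1 ltnS k36 /= => /(_ isT)/orP[/negP[]|//].
by apply/allP => p pk; exact: lt_k.
Qed.

Lemma minimal_power_same_eps : exists g, same_eps u g.
Proof.
have [k_pr|/composite_exponent k_comp] := boolP (prime k).
  apply: prime235_same_eps; have := prime_power_le6 k_pr; move: k_pr k_gt1.
  by clear; case: k => [|[|[|[|[|[|[|]]]]]]].
have := power_8_9_25_excluded; have := power15_excluded; have := power12_excluded; have :=
    power10_excluded.
move: k_comp; rewrite !inE => /or4P[/eqP k4|/eqP k6|->|
  /or4P[->|/eqP k10|/eqP k12|/orP[/eqP k15|->]]];
  rewrite ?orbT //; first by move=> _ _ _ _; exact: power4_same_eps.
by move=> _ _ _ _; exact: power6_same_eps.
Qed.
End MinimalPower.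

(** * Induction on the exponent, and rational conjugacy *)

Lemma torsion_same_eps u n : (0 < n)%N -> u ^+ n = 1 -> augment u = 1 ->
  exists g : GL25, same_eps u g.
Proof.
move=> n_gt0 un u1.
(* The induction on [k] covers all units at once, because it is applied to the powers of [u]; it
   starts from u^n = 1. *)
suff: forall k u z, (0 < k)%N -> u ^+ n = 1 -> augment u = 1 -> scalarGL z ->
    u ^+ k = gr_of int z -> exists g : GL25, same_eps u g.
  by move=> /(_ n u 1%g); apply; rewrite ?sc1 ?gr_of1.
elim/ltn_ind=> k IHk {un u1}u z k_gt0 un u1 scz uk.
pose small j := [exists y, scalarGL y && (u ^+ j == gr_of int y)].
have [/hasP[j]|none] := boolP (has small (iota 1 k.-1)).
  rewrite mem_iota => /andP[j_gt0 j_lt] /existsP[y /andP[scy /eqP uj]].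
  by apply: (IHk j _ u y) => //; lia.
have [k1|k_neq1] := eqVneq k 1%N.
  by exists z => x; rewrite -uk k1 expr1.
have k_gt1 : (1 < k)%N by rewrite ltn_neqAle eq_sym k_neq1.
have /is_scalar_mxP[a za] := scz.
apply: (minimal_power_same_eps n_gt0 un u1 k_gt1 za uk) => [j y jk scy uj|p p_pr pk m].
  case/hasP: none; exists j; first by rewrite mem_iota; lia.
  by apply/existsP; exists y; rewrite scy uj eqxx.
(* The (k/p)-th power of u^(p m) is the scalar z^m, so the induction hypothesis applies to u^(p
   m). *)
have /dvdnP[q Dk] := pk; have p_gt1 := prime_gt1 p_pr.
apply: (IHk q _ _ (z ^+ m)%g).
- by rewrite Dk; nia.
- by lia.
- by rewrite -exprM mulnC exprM un expr1n.
- by rewrite augmentX u1 expr1n.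
- exact: scX.
by rewrite gr_ofX -uk -!exprM; congr (_ ^+ _); rewrite Dk; lia.
Qed.

Lemma torsion_conjugate (u : groupRing int GL25) n : (0 < n)%N -> u ^+ n = 1 ->
  augment u = 1 -> exists x : groupRing rat GL25, x \is a GRing.unit /\
    exists g : GL25, x^-1 * gr_map (intr : int -> rat) u * x = gr_of rat g.
Proof.
move=> n_gt0 un u1; have [g ug] := torsion_same_eps n_gt0 un u1.
have pw m : exists h, same_eps (u ^+ m) h.
  apply: (@torsion_same_eps _ n) => //; last by rewrite augmentX u1 expr1n.
  by rewrite -exprM mulnC exprM un expr1n.
have [|x xu Dx] := @eps_conjugate _ u g n n_gt0 un.
  by move=> i h; rewrite (same_eps_exp pw ug i h) gr_ofX.
by exists x; split=> //; exists g.
Qed.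

Lemma augment_torsion (gT : finGroupType) (u : groupRing int gT) n : (0 < n)%N ->
  u ^+ n = 1 -> augment u = 1 \/ augment u = -1.
Proof.
move=> n_gt0 un; have : `|augment u| ^+ n = 1.
  by rewrite -normrX -augmentX un -gr_of1 augment_of.
move/eqP; rewrite pexpr_eq1 -?lt0n // => /eqP; lia.
Qed.

Theorem mainTheorem2 (u : groupRing int {'GL_2(5)}) (hu : torsion_unit u) :
  exists x : groupRing rat {'GL_2(5)},
    x \is a GRing.unit /\
    exists g : {'GL_2(5)},
      x^-1 * gr_map (intr : int -> rat) u * x = gr_of rat g \/
      x^-1 * gr_map (intr : int -> rat) u * x = - gr_of rat g.
Proof.
case: hu => _ [n [n_gt0 un]].
have [u1|uN1] := augment_torsion n_gt0 un.
  have [x [xu [g Dx]]] := torsion_conjugate n_gt0 un u1.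
  by exists x; split=> //; exists g; left.
have n2_gt0 : (0 < n * 2)%N by rewrite muln_gt0 n_gt0.
have uN : (- u) ^+ (n * 2) = 1 by rewrite mulnC exprM sqrrN -exprM mulnC exprM un expr1n.
have [|x [xu [g Dx]]] := torsion_conjugate n2_gt0 uN.
  by rewrite augmentN uN1 opprK.
exists x; split=> //; exists g; right.
by rewrite -Dx raddfN /= mulrN mulNr opprK.
Qed.
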